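(* Consider the regular solution, on its maximal interval of existence $[0,T_{\max})$, of the spatially homogeneous and isotropic Einstein-Vlasov-Fokker-Planck system with cosmological scalar field, with initial data $(F_0,a_0,H_0,\phi_0)$. If $k\in\{0,-1\}$ and $$\phi_0<\frac{\sigma N}{H_0 a_0^3},$$ then the regular solution blows up in finite time, i.e. $T_{\max}<\infty$. If $k=1$ and $$\phi_0<\frac{9\sigma N^2}{4 a_0^3}\sqrt{\frac{\pi}{2}}\;\mathrm{Erfc}(x)\,e^{x^2},\qquad x=\frac{9H_0N}{4\sqrt{2}},$$ then the regular solution blows up in finite time, i.e. $T_{\max}<\infty$. Here $\mathrm{Erfc}(z)=\frac{2}{\sqrt{\pi}}\int_z^\infty e^{-s^2}\,ds$ is the complementary error function.
   Context: Fix a diffusion constant $\sigma>0$ and a curvature parameter $k\in\{-1,0,1\}$. The spatially homogeneous and isotropic Einstein-Vlasov-Fokker-Planck system with cosmological scalar field is the following system for $F=F(t,v)\ge 0$ ($v\in\mathbb{R}^3$), $a=a(t)>0$, $H=H(t)$, $\phi=\phi(t)$ (summation over repeated indices $i,j\in\{1,2,3\}$): $$\partial_t F=\sigma a(t)\,\partial_{v^i}\Big(\frac{a(t)^2\delta^{ij}+v^iv^j}{\sqrt{a(t)^2+|v|^2}}\,\partial_{v^j}F\Big),\quad \dot a=Ha,\quad \dot H=-\frac{\rho+\mathcal{P}}{2}+\frac{k}{a^2},\quad \dot\phi=-\frac{3\sigma N}{a^3},\quad H^2=\frac13(\rho+\phi)-\frac{k}{a^2},$$ where $$\rho(t)=\frac{1}{a(t)^4}\int_{\mathbb{R}^3}F\sqrt{a(t)^2+|v|^2}\,dv,\qquad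 \mathcal{P}(t)=\frac{1}{3a(t)^4}\int_{\mathbb{R}^3}F\frac{|v|^2}{\sqrt{a(t)^2+|v|^2}}\,dv,$$ and $N=\int_{\mathbb{R}^3}F\,dv$ is the total number of particles, which is conserved in time (so $N=\int F_0\,dv$). Initial data are quadruples $(F_0,a_0,H_0,\phi_0)$ with $F_0:\mathbb{R}^3\to[0,\infty)$ radial ($F_0(v)=\widetilde F_0(|v|)$), not identically zero, $F_0\in X=\mathcal{L}_1\cap H^1$, where $\mathcal{L}_\gamma=\{g:\mathbb{R}^3\to\mathbb{R}: g\in L^1\cap L^2,\ |v|^\gamma g\in L^1\}$, with $a_0>0$, $H_0>0$, $\phi_0>0$, and satisfying the constraint $H_0^2=\frac13(\rho_0+\phi_0)-\frac{k}{a_0^2}$, where $\rho_0=\rho(0)=a_0^{-4}\int F_0\sqrt{a_0^2+|v|^2}\,dv$. A regular solution on $[0,T)$ with these data is a quadruple $(F,a,H,\phi)$ with $F\in C^0((0,T);X)$, $F\ge0$ a.e., $0<a\in C^1((0,T))$, $H,\phi\in C^1((0,T))$, $\lim_{t\to0^+}(a,H,\phi)(t)=(a_0,H_0,\phi_0)$, $\lim_{t\to0^+}\|F(t,\cdot)-F_0\|_{\mathcal{L}_1}=0$, satisfying the system on $(0,T)\times\mathbb{R}^3$ (the Fokker-Planck equation in the weak sense, the ordinary differential equations pointwise). $T_{\max}>0$ denotes the maximal time of existence of the (unique) regular solution with the given data; the solution is global if $T_{\max}=\infty$ and blows up in finite time if $T_{\max}<\infty$. *)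

(* Defs.v *)
From HB Require Import structures.
From mathcomp Require Import all_boot all_order all_algebra.
From mathcomp Require Import all_classical all_reals all_analysis.

Set Implicit Arguments.
Unset Strict Implicit.
Unset Printing Implicit Defensive.

Import Order.TTheory GRing.Theory Num.Theory.
Import numFieldNormedType.Exports.

Local Open Scope classical_set_scope.
Local Open Scope ring_scope.

Section Space.
Context {R : realType}.

Definition leb3 :=
  ((@lebesgue_measure R \x @lebesgue_measure R) \x @lebesgue_measure R)%E.

Definition coord (i : 'I_3) (v : R * R * R) : R :=
  nth 0 [:: v.1.1; v.1.2; v.2] i.

Definition ebase (i : 'I_3) : R * R * R :=
  ((i == 0 :> nat)%:R, (i == 1 :> nat)%:R, (i == 2 :> nat)%:R).

(* The library norm on a product type is the sup norm. *)
Definition enorm (v : R * R * R) : R := Num.sqrt (\sum_(i < 3) coord i v ^+ 2).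

End Space.

Section TestFunctions.
Context {R : realType} {E : normedModType R}.

(* On a finite-dimensional space, [Cn n] is the usual class C^n: all iterated
   directional derivatives of order at most n exist and are continuous. *)
Fixpoint Cn (n : nat) (f : E -> R) : Prop :=
  if n is m.+1 then
    [/\ continuous f, forall x u, derivable f x u & forall u, Cn m ('D_u f)]
  else continuous f.

Definition smooth (f : E -> R) : Prop := forall n, Cn n f.

Definition test_function (O : set E) (psi : E -> R) : Prop :=
  smooth psi /\
  exists K : set E, [/\ compact K, K `<=` O & forall x, ~ K x -> psi x = 0].

End TestFunctions.

Section FunctionSpaces.
Context {R : realType}.
Implicit Types (g h : R * R * R -> R) (gamma : R).

Definition in_L gamma g : Prop :=
  [/\ g \in Lfun leb3 1%E, g \in Lfun leb3 2%:E
    & (fun v => enorm v `^ gamma * g v) \in Lfun leb3 1%E].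

Definition norm_L gamma g : \bar R :=
  ('N[leb3]_1%:E [EFin \o g] + 'N[leb3]_(2%:E) [EFin \o g]
   + 'N[leb3]_1%:E [EFin \o (fun v => (enorm v `^ gamma * g v)%R)])%E.

(* [h] is square integrable and is the distributional derivative of [g]
   with respect to the i-th variable. *)
Definition is_weak_deriv (i : 'I_3) g h : Prop :=
  h \in Lfun leb3 2%:E /\
  forall psi : R * R * R -> R, test_function setT psi ->
    \int[leb3]_v (g v * 'D_(ebase i) psi v) = - \int[leb3]_v (h v * psi v).

Definition in_H1 g : Prop :=
  g \in Lfun leb3 2%:E /\ forall i, exists h, is_weak_deriv i g h.

(* A chosen representative of the weak derivative, which is unique up to
   equality almost everywhere; it is meaningful only for [in_H1 g]. *)
Definition weak_deriv (i : 'I_3) g : R * R * R -> R :=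
  xget (fun=> 0) [set h | is_weak_deriv i g h].

(* The sum of the L^2 norms of [g] and of its weak partial derivatives is
   equivalent to the usual norm of H^1; only the topology matters below. *)
Definition norm_H1 g : \bar R :=
  ('N[leb3]_(2%:E) [EFin \o g]
   + \sum_(i < 3) 'N[leb3]_(2%:E) [EFin \o weak_deriv i g])%E.

Definition in_X g : Prop := in_L 1 g /\ in_H1 g.

Definition norm_X g : \bar R := (norm_L 1 g + norm_H1 g)%E.

End FunctionSpaces.

Section System.
Context {R : realType}.
Implicit Types (g : R * R * R -> R) (A t : R).

Definition num_particles g : R := \int[leb3]_v g v.

Definition energy_density A g : R :=
  (A ^+ 4)^-1 * \int[leb3]_v (g v * Num.sqrt (A ^+ 2 + enorm v ^+ 2)).

Definition pressure A g : R :=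
  (3 * A ^+ 4)^-1 *
  \int[leb3]_v (g v * (enorm v ^+ 2 / Num.sqrt (A ^+ 2 + enorm v ^+ 2))).

Definition diffusion A (i j : 'I_3) (v : R * R * R) : R :=
  (A ^+ 2 * (i == j)%:R + coord i v * coord j v)
  / Num.sqrt (A ^+ 2 + enorm v ^+ 2).

Definition time_interval (T : \bar R) : set R :=
  [set t | 0 < t /\ (t%:E < T)%E].

Definition C1_on (I : set R) (f : R -> R) : Prop :=
  forall t, I t -> derivable f t 1 /\ {for t, continuous f^`()%classic}.

Definition continuous_in_X (I : set R) (F : R -> R * R * R -> R) : Prop :=
  (forall t, I t -> in_X (F t)) /\
  forall t0, I t0 -> norm_X (F t \- F t0) @[t --> t0] --> 0%E.

(* Weak form of  d_t F = sigma a d_i (D^{ij} d_j F)  on (0,T) x R^3, tested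
   against psi(t, v): one integration by parts in t and one in v. *)
Definition fokker_planck_weak (sigma : R) (T : \bar R)
    (F : R -> R * R * R -> R) (a : R -> R) : Prop :=
  forall psi : R * (R * R * R) -> R,
    test_function (time_interval T `*` setT) psi ->
    \int[lebesgue_measure]_(t in time_interval T)
      \int[leb3]_v (F t v * 'D_((1 : R), (0 : R * R * R)) psi (t, v)) =
    \int[lebesgue_measure]_(t in time_interval T)
      \int[leb3]_v (sigma * a t * \sum_(i < 3) \sum_(j < 3)
         diffusion (a t) i j v * weak_deriv j (F t) v
         * 'D_((0 : R), ebase i) psi (t, v)).

Definition friedmann (k : int) (rho A h phi : R) : Prop :=
  h ^+ 2 = 3^-1 * (rho + phi) - k%:~R / A ^+ 2.

Record initial_data (k : int) (F0 : R * R * R -> R) (a0 H0 phi0 : R) : Prop :=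
  InitialData {
    data_ge0 : forall v, 0 <= F0 v ;
    data_radial : exists f : R -> R, forall v, F0 v = f (enorm v) ;
    data_neq0 : ~ {ae leb3, forall v, F0 v = 0} ;
    data_X : in_X F0 ;
    data_a : 0 < a0 ;
    data_H : 0 < H0 ;
    data_phi : 0 < phi0 ;
    data_constraint : friedmann k (energy_density a0 F0) a0 H0 phi0 }.

Record regular_solution (sigma : R) (k : int)
    (F0 : R * R * R -> R) (a0 H0 phi0 : R) (T : \bar R)
    (F : R -> R * R * R -> R) (a H phi : R -> R) : Prop := RegularSolution {
  sol_T : (0 < T)%E ;
  sol_F_cont : continuous_in_X (time_interval T) F ;
  sol_F_ge0 : forall t, time_interval T t -> {ae leb3, forall v, 0 <= F t v} ;
  sol_a_gt0 : forall t, time_interval T t -> 0 < a t ;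
  sol_a_C1 : C1_on (time_interval T) a ;
  sol_H_C1 : C1_on (time_interval T) H ;
  sol_phi_C1 : C1_on (time_interval T) phi ;
  sol_a_init : a t @[t --> 0^'+] --> a0 ;
  sol_H_init : H t @[t --> 0^'+] --> H0 ;
  sol_phi_init : phi t @[t --> 0^'+] --> phi0 ;
  sol_F_init : norm_L 1 (F t \- F0) @[t --> 0^'+] --> 0%E ;
  sol_fokker_planck : fokker_planck_weak sigma T F a ;
  sol_a_ode : forall t, time_interval T t -> a^`()%classic t = H t * a t ;
  sol_H_ode : forall t, time_interval T t ->
    H^`()%classic t = - ((energy_density (a t) (F t) + pressure (a t) (F t)) / 2)
              + k%:~R / a t ^+ 2 ;
  sol_phi_ode : forall t, time_interval T t ->
    phi^`()%classic t = - (3 * sigma * num_particles (F t) / a t ^+ 3) ;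
  sol_constraint : forall t, time_interval T t ->
    friedmann k (energy_density (a t) (F t)) (a t) (H t) (phi t) }.

Definition Tmax (sigma : R) (k : int) (F0 : R * R * R -> R)
    (a0 H0 phi0 : R) : \bar R :=
  ereal_sup [set T | exists F a H phi,
    regular_solution sigma k F0 a0 H0 phi0 T F a H phi].

Definition blows_up_in_finite_time (sigma : R) (k : int) (F0 : R * R * R -> R)
    (a0 H0 phi0 : R) : Prop :=
  (Tmax sigma k F0 a0 H0 phi0 < +oo)%E.

Definition Erfc (z : R) : R :=
  2 / Num.sqrt pi *
  \int[lebesgue_measure]_(s in `[z, +oo[) expR (- s ^+ 2).

End System.

(* Main.v *)
Require Import Defs.
From HB Require Import structures.
From mathcomp Require Import all_boot all_order all_algebra.
From mathcomp Require Import all_classical all_reals all_analysis.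
From mathcomp Require Import measurable_realfun gauss_integral ring lra.
Import Order.TTheory GRing.Theory Num.Theory.
Import numFieldNormedType.Exports.
Local Open Scope classical_set_scope.
Local Open Scope ring_scope.

(* Testing the Fokker-Planck equation against chi(t) eta(|v|^2 / r^2) and
   integrating by parts once more in v (v is an eigenvector of the diffusion
   matrix) leaves an error O(1/r), so that the number of particles N is
   conserved.  The constraint turns the equation for H into
   H' = - H^2 + phi/3 - rho/6 - P/2.  Moreover H' <= c, with c = 0 if k <= 0, and
   c = 16 / (27 N^2) if k = 1, the maximum over a of 1/a^2 - N/(2 a^3), because
   rho >= N/a^3.  Hence H <= H0 + c t, which bounds a^-3 from below by
   a0^-3 exp(- 3 H0 t - 3 c t^2 / 2); integrating the equation for phi, the
   hypothesis on phi0 says exactly that phi drops below some negative constant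
   after a time depending on the data only.  From then on
   H' <= - d (1 + H^2), so atan H drops at rate d and the solution cannot last
   longer than pi/d. *)

(* The library's [vector.coord] shadows the coordinates of [Defs]. *)
Local Notation coord := Defs.coord.

(** * Differential inequalities and blow-up *)

(** [Tmax] is a supremum over all regular solutions, so the task is to bound [T] by the data alone;
    the bound obtained is t1 + pi/d. Conservation of [N] is not part of [regular_solution], and most
    of the work goes there: [F] has only a first moment, and its weak derivatives in v are only
    square integrable. The eigenvector identity puts the flux of the cut-off in closed form, smooth
    and compactly supported, so that the flux can itself serve as a test function for the weak
    derivatives. The diffusion matrix grows linearly in |v| and two derivatives of the cut-off cost
    r^-2, whence an error (a + r) / r^2; the tail that is cut off costs the first moment over r.
    Both thresholds are 3 sigma N / a0^3 times the integral over (0, oo) of exp(- 3 H0 t - 3 c t^2 /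
    2): this is 1 / (3 H0) for c = 0, and for c > 0, where the exponent is x^2 - (x + b t)^2, a
    Gaussian tail starting at x. Strictness of the hypothesis leaves room to stop the integral at a
    finite t1. *)

Lemma is_derive_mulr {R : realType} (c x : R) : is_derive x 1 ( *%R c) c.
Proof. by apply: is_derive_eq; rewrite /GRing.scale/= mulr1. Qed.

Section TimeInterval.
Context {R : realType}.
Implicit Types (T : \bar R) (f df : R -> R).

Lemma time_interval_le T s t : time_interval T t -> 0 < s -> s <= t ->
  time_interval T s.
Proof.
move=> [_ tT] s0 st; split => //.
by apply: le_lt_trans tT; rewrite lee_fin.
Qed.

Lemma nonincreasing_time_interval T f df :
  (forall t, time_interval T t -> is_derive t 1 f (df t)) ->
  (forall t, time_interval T t -> df t <= 0) ->
  forall s t, time_interval T t -> 0 < s -> s <= t -> f t <= f s.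
Proof.
move=> fdf df0 s t It s0 st.
have I x : s <= x -> x <= t -> time_interval T x.
  by move=> sx; apply: time_interval_le => //; exact: lt_le_trans sx.
have dif x : x \in `[s, t] -> is_derive x 1 f (df x).
  by rewrite in_itv/= => /andP[sx xt]; apply: fdf; exact: I.
apply: (@ler0_derive1_le_cc R f s t) => //.
- by move=> x /subset_itv_oo_cc /dif [].
- move=> x /[dup] /subset_itv_oo_cc /dif dfx.
  rewrite in_itv/= => /andP[sx xt].
  by rewrite derive1E derive_val; apply: df0; apply: I; exact: ltW.
- by apply: derivable_within_continuous => x /dif [].
- by rewrite in_itv/= lexx st.
- by rewrite in_itv/= lexx st.
Qed.

(** The equations hold on the open interval only, so the initial value enters as the limit of [f s]
    for s -> 0+, each [f s] with s <= t being at least [f t]. *)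
Lemma le_initial_value T f df l :
  (forall t, time_interval T t -> is_derive t 1 f (df t)) ->
  (forall t, time_interval T t -> df t <= 0) ->
  f t @[t --> 0^'+] --> l ->
  forall t, time_interval T t -> f t <= l.
Proof.
move=> fdf df0 fl t It; have t0 := It.1.
rewrite -(cvg_lim _ fl)//; apply: limr_ge; first by apply/cvg_ex; exists l.
near=> s; apply: (nonincreasing_time_interval _ _ _ fdf df0) => //.
by near: s; exact: nbhs_right_le.
Unshelve. all: by end_near. Qed.

Lemma ge_initial_value T f df l :
  (forall t, time_interval T t -> is_derive t 1 f (df t)) ->
  (forall t, time_interval T t -> 0 <= df t) ->
  f t @[t --> 0^'+] --> l ->
  forall t, time_interval T t -> l <= f t.
Proof.
move=> fdf df0 fl t It; rewrite -lerN2.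
apply: (@le_initial_value T (- f) (fun t => - df t)) => //.
- by move=> u /fdf ?; exact: is_deriveN.
- by move=> u Iu; rewrite oppr_le0 df0.
- exact: cvgN.
Qed.

(* Along [H' <= - d (1 + H^2)] the angle [atan H] decreases at rate at least
   [d], but it ranges over an interval of length [pi]. *)
Lemma riccati_lifespan T (H dH : R -> R) (t1 d : R) :
  0 < t1 -> 0 < d ->
  (forall t, time_interval T t -> is_derive t 1 H (dH t)) ->
  (forall t, time_interval T t -> t1 <= t -> dH t <= - (d * (1 + H t ^+ 2))) ->
  (T <= (t1 + pi / d)%:E)%E.
Proof.
move=> t10 d0 HdH Hle; rewrite leNgt; apply/negP => TT.
have pd0 : 0 < pi / d by rewrite divr_gt0// pi_gt0.
set t2 := t1 + pi / d.
have It2 : time_interval T t2 by split => //; rewrite addr_gt0.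
have I t : t1 <= t <= t2 -> time_interval T t.
  by move=> /andP[tt1 tt2]; apply: time_interval_le It2 _ tt2; exact: lt_le_trans tt1.
pose f t := atan (H t) + d * t.
have df t : t1 <= t <= t2 ->
    is_derive t 1 f ((1 + H t ^+ 2)^-1 * dH t + d).
  move=> tt; have Ht := HdH t (I t tt).
  have h1 := is_derive1_comp (is_derive1_atan (H t)) Ht.
  exact: (is_deriveD h1 (is_derive_mulr d t)).
have : f t2 <= f t1.
  have t12 : t1 <= t2 by rewrite lerDl ltW.
  apply: (@ler0_derive1_le_cc R f t1 t2); rewrite ?in_itv/= ?lexx ?t12//.
  - by move=> x /subset_itv_oo_cc; rewrite in_itv/= => /df [].
  - move=> x /subset_itv_oo_cc; rewrite in_itv/= => xx; have dfx := df x xx.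
    rewrite derive1E derive_val.
    have HH : 0 < 1 + H x ^+ 2 by rewrite ltr_pwDl// sqr_ge0.
    have : dH x <= - (d * (1 + H x ^+ 2)).
      by apply: Hle; [exact: I | case/andP: xx].
    rewrite -(ler_pM2l (_ : 0 < (1 + H x ^+ 2)^-1)) ?invr_gt0// => h.
    rewrite -lerBrDr sub0r (le_trans h)// mulrN mulrCA mulVf ?mulr1//.
    by rewrite gt_eqF.
  - apply: derivable_within_continuous => x; rewrite in_itv/= => /df [] //.
rewrite /f /t2 mulrDr mulrCA divff ?gt_eqF// mulr1.
(* The inequality now says that [atan (H t)] has dropped by at least pi, while both of its values
   lie strictly between - pi/2 and pi/2. *)
have := atan_gtNpi2 (H t2); have := atan_ltpi2 (H t1); rewrite /t2.
lra.
Qed.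

End TimeInterval.

Section Blowup.
Context {R : realType}.

(** Here [s] stands for 3 sigma N. The primitive [J] stays abstract so that one argument serves all
    curvatures: it is elementary for c = 0 and a Gaussian integral for c > 0. *)
Lemma cosmological_lifespan (T : \bar R) (a H phi dH J : R -> R)
    (a0 H0 phi0 s c t1 : R) :
  0 < a0 -> 0 <= s -> 0 < t1 ->
  (forall t, time_interval T t -> 0 < a t) ->
  (forall t, time_interval T t -> is_derive t 1 a (H t * a t)) ->
  (forall t, time_interval T t -> is_derive t 1 H (dH t)) ->
  (forall t, time_interval T t -> is_derive t 1 phi (- (s / a t ^+ 3))) ->
  (forall t, time_interval T t -> dH t <= c) ->
  (forall t, time_interval T t -> dH t <= - H t ^+ 2 + phi t / 3) ->
  a t @[t --> 0^'+] --> a0 ->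
  H t @[t --> 0^'+] --> H0 ->
  phi t @[t --> 0^'+] --> phi0 ->
  (forall t : R, is_derive t 1 J (expR (- (3 * H0 * t + 3 / 2 * c * t ^+ 2)))) ->
  J 0 = 0 ->
  phi0 < s / a0 ^+ 3 * J t1 ->
  (T <= (t1 + pi / Num.min 1 ((s / a0 ^+ 3 * J t1 - phi0) / 3))%:E)%E.
Proof.
move=> a00 s0 t10 apos da dHH dphi dHc ric a_init H_init phi_init dJ J0 phi0J.
(* After t1 one has phi / 3 <= - q, where q is the second argument of the minimum; H^2 + q >= d (1 +
   H^2) follows from d <= 1 and d <= q. *)
set d := Num.min _ _.
have d0 : 0 < d by rewrite lt_min ltr01/= divr_gt0// subr_gt0.
have cvg_right0 (f : R -> R) : derivable f 0 1 -> f t @[t --> 0^'+] --> f 0.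
  move=> /derivable1_diffP/differentiable_continuous; exact: cvg_at_right_filter.
have Hle t : time_interval T t -> H t <= H0 + c * t.
  move=> It; rewrite -lerBlDr.
  apply: (@le_initial_value _ T (fun t => H t - c * t) (fun t => dH t - c)) It.
  - by move=> u /dHH Hu; exact: (is_deriveB Hu (is_derive_mulr c u)).
  - by move=> u /dHc; rewrite subr_le0.
  - rewrite -[X in _ --> X]subr0; apply: cvgB => //.
    rewrite -[X in _ --> X](mulr0 c).
    by apply: (cvg_right0 ( *%R c)).
pose E t : R := 3 * H0 * t + 3 / 2 * c * t ^+ 2.
have dE (t : R) : is_derive t 1 E (3 * H0 + 3 * c * t).
  apply: is_derive_eq.
  by rewrite /GRing.scale/=; field.
have alow t : time_interval T t -> a0 ^- 3 * expR (- E t) <= a t ^- 3.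
  move=> It.
  rewrite expRN ler_pdivrMr ?expR_gt0//.
  (* [expR (E t)] is an integrating factor: a^-3 e^E has logarithmic derivative 3 (H0 + c t - H),
     nonnegative by [Hle]. *)
  apply: (@ge_initial_value _ T (fun t => a t ^- 3 * expR (E t))
    (fun t => a t ^- 3 * expR (E t) * (3 * (H0 + c * t - H t)))) It.
  - move=> u Iu; have ? := da u Iu; have au := apos _ Iu.
    have au0 : a u != 0 by rewrite gt_eqF.
    have ? : is_derive u 1 (fun t => a t ^+ 3) (3 * a u ^+ 2 * (H u * a u)).
      apply: is_derive_eq; rewrite /GRing.scale/=; ring.
    have ? : is_derive u 1 (fun t => a t ^- 3)
        (- (a u ^+ 3) ^- 2 * (3 * a u ^+ 2 * (H u * a u))).
      have a3 : a u ^+ 3 != 0 by rewrite expf_neq0.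
      split; first by apply: derivableV.
      by rewrite deriveV// derive_val.
    have ? : is_derive u 1 (expR \o E) (expR (E u) * (3 * H0 + 3 * c * u)).
      exact: is_derive1_comp.
    apply: is_derive_eq.
    rewrite /GRing.scale/=; field; exact: au0.
  - move=> u Iu; rewrite mulr_ge0//.
      by rewrite mulr_ge0 ?expR_ge0// invr_ge0 exprn_ge0// ltW// apos.
    by rewrite mulr_ge0// subr_ge0 Hle.
  - rewrite -[X in _ --> X]mulr1; apply: cvgM.
      apply: cvgV; first by rewrite expf_neq0// gt_eqF.
      by rewrite !exprS expr0 !mulr1; apply: cvgM => //; apply: cvgM.
    have -> : 1 = expR (E 0) by rewrite /E expr0n/= !mulr0 addr0 expR0.
    apply: (cvg_right0 (expR \o E)).
    have := is_derive1_comp (is_derive_expR (E 0)) (dE 0).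
    by case.
have phile t : time_interval T t -> phi t <= phi0 - s / a0 ^+ 3 * J t.
  move=> It; rewrite lerBrDr.
  apply: (@le_initial_value _ T (fun t => phi t + s / a0 ^+ 3 * J t)
    (fun t => - (s / a t ^+ 3) + s / a0 ^+ 3 * expR (- E t))) It.
  - move=> u Iu; have ? := dphi u Iu; have ? := dJ u.
    by apply: is_deriveD; exact: is_deriveZ.
  - move=> u Iu; rewrite addrC subr_le0 -mulrA ler_wpM2l//; exact: alow.
  - rewrite -[X in _ --> X]addr0; apply: cvgD => //.
    rewrite -[X in _ --> X](mulr0 (s / a0 ^+ 3)); apply: cvgM; first exact: cvg_cst.
    by rewrite -[X in _ --> X]J0; apply: cvg_right0; case: (dJ 0).
apply: (@riccati_lifespan _ T H dH) => // t It t1t.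
have t1I : time_interval T t1 by exact: time_interval_le It _ _.
(* phi is nonincreasing, so the negative bound reached at t1 persists. *)
have phi1 : phi t <= phi t1.
  apply: (nonincreasing_time_interval _ _ _ dphi) => // u Iu.
  by rewrite oppr_le0 divr_ge0// exprn_ge0// ltW// apos.
have phi2 := phile _ t1I.
have phi3 : phi t / 3 <= - ((s / a0 ^+ 3 * J t1 - phi0) / 3) by lra.
have dd : d <= (s / a0 ^+ 3 * J t1 - phi0) / 3 by rewrite ge_min lexx orbT.
have d1 : d <= 1 by rewrite ge_min lexx.
have h := ric _ It.
have : d * H t ^+ 2 <= H t ^+ 2 by rewrite ler_piMl ?sqr_ge0.
lra.
Qed.

End Blowup.

(** * Smooth functions *)

Section Cn.
Context {R : realType} {E : normedModType R}.
Implicit Types (f g : E -> R) (n : nat).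

Lemma derive_along_line f (x u : E) : 'D_u f x = 'D_1 (fun h : R => f (h *: u + x)) 0.
Proof.
rewrite /derive; set g1 := fun h => h^-1 *: _; set g2 := fun h => h^-1 *: _.
suff -> : g1 = g2 by [].
apply/funext => h; rewrite /g1 /g2 /=.
by rewrite addr0 scale0r add0r [_%:A]mulr1.
Qed.

(** [f] is only known to be derivable along the direction [u], so the one-variable chain rule is
    applied to its restriction to the line through [x]. *)
Lemma is_derive_comp1 (h : R -> R) f (x u : E) (dh df : R) :
  is_derive (f x) 1 h dh -> is_derive x u f df ->
  is_derive x u (h \o f) (dh * df).
Proof.
move=> hdh [/derivable1P fxu]; rewrite derive_along_line => <-.
set p := fun s : R => f (s *: u + x).
have p0 : p 0 = f x by rewrite /p scale0r add0r.
have dp : is_derive (0 : R) 1 p ('D_1 p 0) by apply: derivableP.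
have hdp : is_derive (p 0) 1 h dh by rewrite p0.
have [d1 d2] := is_derive1_comp hdp dp.
by split; [apply/derivable1P | rewrite derive_along_line].
Qed.

(** The form in which [Cn] is established below: explicit formulas [df] take the place of ['D_u f],
    and the induction on [n] runs on these formulas. *)
Lemma CnS_is_derive n f (df : E -> E -> R) :
  continuous f -> (forall x u, is_derive x u f (df u x)) ->
  (forall u, Cn n (df u)) -> Cn n.+1 f.
Proof.
move=> cf dfE Cdf; split => [//|x u|u]; first by case: (dfE x u).
suff -> : 'D_u f = df u by exact: Cdf.
by apply/funext => x; case: (dfE x u).
Qed.

Lemma Cn_is_derive n f x u : Cn n.+1 f -> is_derive x u f ('D_u f x).
Proof. by case=> _ df _; exact/derivableP. Qed.

Lemma Cn_continuous n f : Cn n f -> continuous f.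
Proof. by case: n => [//|n []]. Qed.

Lemma CnW n f : Cn n.+1 f -> Cn n f.
Proof.
elim: n f => [f []//|n IH f [cf df Cdf]]; split => // u.
exact/IH/Cdf.
Qed.

Lemma Cn_cst n (c : R) : Cn n (fun _ : E => c).
Proof.
elim: n c => [|n IH] c; first exact: cst_continuous.
by apply: (@CnS_is_derive n _ (fun _ _ => 0)) => //; exact: cst_continuous.
Qed.

Lemma is_derive_linear f (x u : E) :
  (forall (s : R) (y z : E), f (s *: y + z) = s * f y + f z) ->
  is_derive x u f (f u).
Proof.
move=> fl.
suff h : h^-1 *: (f (h *: u + x) - f x) @[h --> (0 : R)^'] --> f u.
  by split; [apply/cvg_ex; exists (f u) | exact: (cvg_lim _ h)].
apply: cvg_near_cst; near=> h.
rewrite fl addrK /GRing.scale/= mulrA mulVf ?mul1r//.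
near: h; exact: nbhs_dnbhs_neq.
Unshelve. all: by end_near. Qed.

Lemma Cn_linear n f :
  (forall (s : R) (y z : E), f (s *: y + z) = s * f y + f z) -> continuous f ->
  Cn n f.
Proof.
case: n => [//|n] fl cf; apply: (@CnS_is_derive n _ (fun u _ => f u)) => //.
  by move=> x u; exact: is_derive_linear.
by move=> u; exact: Cn_cst.
Qed.

Lemma CnD n f g : Cn n f -> Cn n g -> Cn n (fun x => f x + g x).
Proof.
elim: n f g => [|n IH] f g Cf Cg; first by move=> x; apply: cvgD; [exact: Cf|exact: Cg].
apply: (@CnS_is_derive n _ (fun u x => 'D_u f x + 'D_u g x)).
- by move=> x; apply: cvgD; [exact: (Cn_continuous _ _ Cf)|exact: (Cn_continuous _ _ Cg)].
- move=> x u; have h1 := Cn_is_derive n f x u Cf; have h2 := Cn_is_derive n g x u Cg.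
  exact: (is_deriveD h1 h2).
- by move=> u; apply: IH; [have [_ _] := Cf; apply | have [_ _] := Cg; apply].
Qed.

Lemma CnM n f g : Cn n f -> Cn n g -> Cn n (fun x => f x * g x).
Proof.
elim: n f g => [|n IH] f g Cf Cg; first by move=> x; apply: cvgM; [exact: Cf|exact: Cg].
apply: (@CnS_is_derive n _ (fun u x => f x * 'D_u g x + g x * 'D_u f x)).
- by move=> x; apply: cvgM; [exact: (Cn_continuous _ _ Cf)|exact: (Cn_continuous _ _ Cg)].
- move=> x u; have h1 := Cn_is_derive n f x u Cf; have h2 := Cn_is_derive n g x u Cg.
  exact: (is_deriveM h1 h2).
- move=> u; apply: CnD; apply: IH; (try exact: CnW);
    by [have [_ _] := Cf; apply | have [_ _] := Cg; apply].
Qed.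

Lemma is_derive_inv f (x u : E) (df : R) : f x != 0 -> is_derive x u f df ->
  is_derive x u (fun y => (f y)^-1) (- (f x)^-1 ^+ 2 * df).
Proof.
move=> fx0 [dfx <-]; split; first exact: derivableV.
by rewrite deriveV// /GRing.scale/= exprVn.
Qed.

Lemma CnV n f : (forall x, f x != 0) -> Cn n f -> Cn n (fun x => (f x)^-1).
Proof.
move=> f0; elim: n => [|n IH] Cf; first by move=> x; apply: cvgV => //; exact: Cf.
apply: (@CnS_is_derive n _ (fun u x => - (f x)^-1 ^+ 2 * 'D_u f x)).
- by move=> x; apply: cvgV => //; exact: (Cn_continuous _ _ Cf).
- by move=> x u; apply: is_derive_inv => //; exact: Cn_is_derive Cf.
- have C1 := IH (CnW _ _ Cf).
  move=> u; have -> : (fun x => - (f x)^-1 ^+ 2 * 'D_u f x) =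
     (fun x => (-1 * ((f x)^-1 * (f x)^-1)) * 'D_u f x).
    by apply/funext => x; rewrite expr2 mulN1r.
  apply: CnM; last by have [_ _] := Cf; apply.
  by apply: CnM; [exact: Cn_cst | exact: CnM].
Qed.

Lemma smooth_cst (c : R) : smooth (fun _ : E => c).
Proof. by move=> n; exact: Cn_cst. Qed.

Lemma smoothD f g : smooth f -> smooth g -> smooth (fun x => f x + g x).
Proof. by move=> sf sg n; exact: CnD. Qed.

Lemma smoothM f g : smooth f -> smooth g -> smooth (fun x => f x * g x).
Proof. by move=> sf sg n; exact: CnM. Qed.

Lemma smoothN f : smooth f -> smooth (fun x => - f x).
Proof.
move=> sf; under eq_fun do rewrite -mulN1r.
by apply: smoothM => //; exact: smooth_cst.
Qed.

Lemma smoothV f : (forall x, f x != 0) -> smooth f -> smooth (fun x => (f x)^-1).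
Proof. by move=> f0 sf n; exact: CnV. Qed.

(* The square root is not smooth at 0, so that this is not an instance of
   composition; instead [D_u (1/w) = - w^-3 D_u f / 2] closes an induction. *)
Lemma smooth_sqrt f : (forall x, 0 < f x) -> smooth f ->
  smooth (fun x => Num.sqrt (f x)).
Proof.
move=> f0 sf.
have w0 x : Num.sqrt (f x) != 0 by rewrite gt_eqF// sqrtr_gt0.
have dw x u : is_derive x u (fun x => Num.sqrt (f x))
    (2^-1 * (Num.sqrt (f x))^-1 * 'D_u f x).
  have := is_derive_comp1 Num.sqrt f x u _ _ (is_derive1_sqrt (f0 x))
    (Cn_is_derive 0 f x u (sf 1)).
  by rewrite invfM.
have cw : continuous (fun x => Num.sqrt (f x)).
  by move=> x; apply: continuous_comp; [exact: (sf 0) | exact: sqrt_continuous].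
have sV : smooth (fun x => (Num.sqrt (f x))^-1).
  elim=> [|n IH]; first by move=> x; apply: cvgV => //; exact: cw.
  pose v x := (Num.sqrt (f x))^-1.
  apply: (@CnS_is_derive n _ (fun u x => (- 2^-1) * (v x * (v x * v x)) * 'D_u f x)).
  - by move=> x; apply: cvgV => //; exact: cw.
  - move=> x u; have := is_derive_inv _ x u _ (w0 x) (dw x u).
    by congr (is_derive _ _ _ _); rewrite /v; ring.
  - move=> u; apply: CnM; last by have [_ _] := sf n.+1; apply.
    by apply: CnM; [exact: Cn_cst|exact/CnM/CnM].
have -> : (fun x => Num.sqrt (f x)) = (fun x => f x * (Num.sqrt (f x))^-1).
  apply/funext => x; rewrite -{2}(sqr_sqrtr (ltW (f0 x))).
  by rewrite expr2 mulfK.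
exact: smoothM.
Qed.

End Cn.

Section SmoothComp.
Context {R : realType} {E : normedModType R}.

Lemma Cn_comp n (h : R -> R) (f : E -> R) : Cn n h -> Cn n f ->
  Cn n (fun x => h (f x)).
Proof.
elim: n h f => [|n IH] h f Ch Cf.
  by move=> x; apply: continuous_comp; [exact: Cf|exact: Ch].
apply: (@CnS_is_derive _ _ n _ (fun u x => 'D_1 h (f x) * 'D_u f x)).
- move=> x; apply: continuous_comp; first exact: (Cn_continuous _ _ Cf).
  exact: (Cn_continuous n.+1 h Ch).
- move=> x u; apply: is_derive_comp1; first exact: (Cn_is_derive n).
  exact: (Cn_is_derive n).
- move=> u; apply: CnM; last by have [_ _] := Cf; apply.
  by apply: (IH ('D_1 h)); [have [_ _] := Ch; apply|exact: CnW].
Qed.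

Lemma smooth_comp (h : R -> R) (f : E -> R) : smooth h -> smooth f ->
  smooth (fun x => h (f x)).
Proof. by move=> sh sf n; exact: Cn_comp. Qed.

End SmoothComp.

(** * Functions vanishing to infinite order at the origin *)

Section Bump.
Context {R : realType}.
Implicit Types x : R.

(* Closed under differentiation: [flat k]' = [flat (k + 2)] - k [flat (k + 1)]. *)
Definition flat (k : nat) (x : R) : R :=
  if 0 < x then x ^- k * expR (- x^-1) else 0.

Lemma flat_ge0 k x : 0 <= flat k x.
Proof.
rewrite /flat; case: ifP => // x0.
by rewrite mulr_ge0 ?expR_ge0// invr_ge0 exprn_ge0// ltW.
Qed.

Lemma flat_gt0 k x : 0 < x -> 0 < flat k x.
Proof.
by move=> x0; rewrite /flat x0 mulr_gt0 ?expR_gt0// invr_gt0 exprn_gt0.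
Qed.

Lemma flat_le0 k x : x <= 0 -> flat k x = 0.
Proof. by rewrite /flat leNgt => /negbTE ->. Qed.

(** From exp(y) >= y^(k+2) / (k+2)! at y = 1/x. The power 2 makes the difference quotient at 0 tend
    to 0; the same estimate later bounds the derivatives of the cut-off profile. *)
Lemma flat_le k x : flat k x <= (k.+2)`!%:R * x ^+ 2.
Proof.
case: (leP x 0) => [x0|x0]; first by rewrite flat_le0// mulr_ge0// sqr_ge0.
rewrite /flat x0 expRN ler_pdivrMr ?expR_gt0// -ler_pdivrMl; last first.
  by rewrite mulr_gt0// ?exprn_gt0// ltr0n fact_gt0.
have xV0 : 0 <= x^-1 by rewrite invr_ge0 ltW.
have : x^-1 ^+ k.+2 / (k.+2)`!%:R <= expR x^-1.
  by rewrite (le_trans _ (expR_ge1Dxn k.+1 xV0))// lerDr.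
apply: le_trans; rewrite le_eqVlt; apply/orP; left; apply/eqP.
have f0 : (k.+2)`!%:R != 0 :> R by rewrite pnatr_eq0 -lt0n fact_gt0.
have xn : x != 0 by rewrite gt_eqF.
by rewrite !exprVn !exprS; field; rewrite f0 xn expf_neq0.
Qed.


Lemma is_derive_flat k x :
  is_derive x 1 (flat k) (flat k.+2 x - k%:R * flat k.+1 x).
Proof.
have [x0|x0|->] := ltgtP x 0.
- rewrite !flat_le0 ?ltW// mulr0 subrr.
  apply: (@near_eq_is_derive R R R (cst 0)).
  near=> y; rewrite flat_le0// ltW//.
  by near: y; exact: lt_nbhsl.
- have xn0 : x != 0 by rewrite gt_eqF.
  have dV : is_derive x 1 (fun y : R => y^-1) (- x^-1 ^+ 2).
    have := is_derive_inv id x 1 1 xn0 (is_derive_id x 1).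
    by rewrite mulr1.
  have dE : is_derive x 1 (fun y : R => expR (- y^-1)) (expR (- x^-1) * x^-1 ^+ 2).
    have := is_deriveN dV; rewrite opprK => dN.
    exact: (is_derive_comp1 expR _ x 1 _ _ (is_derive_expR (- x^-1)) dN).
  have dX : is_derive x 1 (fun y : R => y^-1 ^+ k) (k%:R * x^-1 ^+ k.-1 * - x^-1 ^+ 2).
    by have := is_deriveX k dV; rewrite exprfctE.
  have := is_deriveM dX dE.
  rewrite /flat x0 => dM.
  apply: (@near_eq_is_derive R R R (fun y => y^-1 ^+ k * expR (- y^-1))).
    near=> y; have -> : 0 < y by near: y; exact: lt_nbhsr.
    by rewrite exprVn.
  apply: is_derive_eq.
  rewrite /GRing.scale/= -!exprVn.
  case: k {dX dM} => [|k]; first by rewrite !mul0r !mulr0 subr0 expr0; ring.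
  by rewrite /= !exprS; ring.
- rewrite !flat_le0 ?ltexx// mulr0 subrr.
  (* At the gluing point 0, [flat_le] bounds the difference quotient by C |h|. *)
  pose C : R := (k.+2)`!%:R.
  suff h : h^-1 *: (flat k (h *: 1 + 0) - flat k 0) @[h --> (0 : R)^'] --> (0 : R).
    by split; [apply/cvg_ex; exists 0 | exact: (cvg_lim _ h)].
  apply/cvgr0Pnorm_le => e e0; near=> h.
  rewrite addr0 (flat_le0 _ 0)// subr0 [h%:A]mulr1 normrM normfV.
  have h0 : h != 0 by near: h; exact: nbhs_dnbhs_neq.
  rewrite ler_pdivrMl ?normr_gt0// ger0_norm ?flat_ge0//.
  rewrite (le_trans (flat_le _ _))// -/C -normr_id -real_normK ?num_real//.
  rewrite expr2 normr_id mulrCA ler_wpM2l// mulrC -ler_pdivlMr; last first.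
    by rewrite ltr0n fact_gt0.
  near: h; apply: dnbhs0_le.
  by rewrite divr_gt0// ltr0n fact_gt0.
Unshelve. all: by end_near. Qed.

Lemma smooth_flat k : smooth (flat k).
Proof.
move=> n; elim: n k => [|n IH] k.
  move=> x; apply/differentiable_continuous/derivable1_diffP.
  by case: (is_derive_flat k x).
apply: (@CnS_is_derive _ _ n _ (fun u x => (flat k.+2 x - k%:R * flat k.+1 x) * u)).
- move=> x; apply/differentiable_continuous/derivable1_diffP.
  by case: (is_derive_flat k x).
- move=> x u.
  exact: (is_derive_comp1 (flat k) id x u _ _ (is_derive_flat k x) (is_derive_id x u)).
- move=> u; apply: CnM; last exact: Cn_cst.
  apply: CnD => //.
  under eq_fun do rewrite -mulNr.
  by apply: CnM; first exact: Cn_cst.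
Qed.

End Bump.

(** * Velocity moments *)

Section Moments.
Context {R : realType}.
Notation V := (R * R * R)%type.
Notation mu := (@leb3 R).
Implicit Types (v : V) (f g w : V -> R) (C : R).

Lemma enorm_ge0 v : 0 <= enorm v.
Proof. exact: sqrtr_ge0. Qed.

Lemma enorm_sqr v : enorm v ^+ 2 = \sum_(i < 3) coord i v ^+ 2.
Proof. by rewrite sqr_sqrtr// sumr_ge0// => i _; rewrite sqr_ge0. Qed.

Lemma coord_le_enorm i v : `|coord i v| <= enorm v.
Proof.
rewrite -(@ler_pXn2r _ 2)// ?nnegrE ?enorm_ge0// enorm_sqr real_normK ?num_real//.
by rewrite (bigD1 i)//= lerDl sumr_ge0// => j _; rewrite sqr_ge0.
Qed.

Lemma measurable_coord i : measurable_fun setT (@coord R i).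
Proof.
rewrite /coord; case: i => [[|[|[|//]]] ?] /=.
- exact: (measurableT_comp measurable_fst measurable_fst).
- exact: (measurableT_comp measurable_snd measurable_fst).
- exact: measurable_snd.
Qed.

Lemma measurable_enorm : measurable_fun setT (@enorm R).
Proof.
apply: (@measurableT_comp _ _ _ _ _ _ (@Num.sqrt R)) => //.
  by apply: continuous_measurable_fun; exact: sqrt_continuous.
under eq_fun do rewrite !big_ord_recr big_ord0 /=.
by do 3 (apply: measurable_funD => //; try (apply: measurable_funX; exact: measurable_coord)).
Qed.

Lemma in_L1E g : in_L 1 g -> [/\ measurable_fun setT g,
  mu.-integrable setT (EFin \o g)
  & mu.-integrable setT (EFin \o (fun v => enorm v * g v))].
Proof.
case=> /Lfun1_integrable i1 _ /Lfun1_integrable i2; split => //.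
  by apply/measurable_EFinP; case/integrableP : i1.
apply: eq_integrable i2 => // v _ /=.
by rewrite powRr1// enorm_ge0.
Qed.

(** Weights of at most linear growth are the ones that [in_L 1] controls; every moment below has
    such a weight. *)
Lemma integrable_moment g w C : in_L 1 g -> measurable_fun setT w ->
  (forall v, `|w v| <= C * (1 + enorm v)) ->
  mu.-integrable setT (EFin \o (fun v => g v * w v)).
Proof.
move=> /in_L1E[mg i1 i2] mw wC.
have h := integrableD measurableT (integrable_norm i1) (integrable_norm i2).
have {}h := integrableZl measurableT C h.
apply: (le_integrable measurableT _ _ h).
  by apply/measurable_EFinP; exact: measurable_funM.
move=> v _ /=; rewrite lee_fin.
rewrite (normrM (enorm v)) (ger0_norm (enorm_ge0 v)).
rewrite normrM (le_trans (ler_wpM2l _ (wC v)))// -[leLHS]ger0_norm.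
  rewrite le_eqVlt; apply/orP; left; apply/eqP; congr `|_|; ring.
by rewrite mulr_ge0// (le_trans _ (wC v)).
Qed.

Definition moment g w : R := \int[mu]_v (g v * w v).

(** The plain and the weighted L^1 summands of [norm_L 1] together dominate the integral of |g1 -
    g2| (1 + |v|), so each moment is Lipschitz for this norm. *)
Lemma moment_le g1 g2 w C : in_L 1 g1 -> in_L 1 g2 -> measurable_fun setT w ->
  0 <= C -> (forall v, `|w v| <= C * (1 + enorm v)) ->
  (`|moment g1 w - moment g2 w|%:E <=
    C%:E * norm_L 1 (g1 \- g2)%R)%E.
Proof.
move=> Lg1 Lg2 mw C0 wC.
have [mg1 i1 i1'] := in_L1E _ Lg1; have [mg2 i2 i2'] := in_L1E _ Lg2.
have h1 := integrable_moment _ _ _ Lg1 mw wC.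
have h2 := integrable_moment _ _ _ Lg2 mw wC.
rewrite /moment -RintegralB// EFin_normr_Rintegral//; last exact: (integrableB measurableT h1 h2).
have mh : measurable_fun setT (fun v => g1 v * w v - g2 v * w v).
  by apply: measurable_funB; exact: measurable_funM.
apply: (le_trans (le_abse_integral _ _ _)) => //; first exact/measurable_EFinP.
rewrite /norm_L !Lnorm1 -addeA addeCA.
set d := (g1 \- g2)%R; set de := (fun v => enorm v `^ 1 * d v)%R.
have md : measurable_fun setT d by exact: measurable_funB.
have me : measurable_fun setT de.
  apply: measurable_funM => //; under eq_fun do rewrite powRr1 ?enorm_ge0//.
  exact: measurable_enorm.
apply: (@le_trans _ _ (C%:E * (\int[mu]_v `|(EFin \o d) v| +
   \int[mu]_v `|(EFin \o de) v|))%E).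
  have ma : measurable_fun setT (fun v => `|(EFin \o d) v|)%E.
    by apply: measurableT_comp => //; exact/measurable_EFinP.
  have mb : measurable_fun setT (fun v => `|(EFin \o de) v|)%E.
    by apply: measurableT_comp => //; exact/measurable_EFinP.
  have mab := emeasurable_funD ma mb.
  rewrite -ge0_integralD// -ge0_integralZl ?lee_fin//; last first.
    by move=> v _; rewrite adde_ge0.
  apply: ge0_le_integral => //.
  - by apply: measurableT_comp => //; exact/measurable_EFinP.
  - exact: measurable_funeM.
  - move=> v _ /=; rewrite -EFinD -EFinM lee_fin -mulrBl.
    rewrite /de /d /= powRr1 ?enorm_ge0// !normrM (ger0_norm (enorm_ge0 v)) -{2}(mul1r `|_ - _|).
    by rewrite -mulrDl mulrC mulrA ler_wpM2r.
by rewrite lee_wpmul2l// ?lee_fin// leeDr// Lnorm_ge0.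
Qed.


Lemma moment_ge0 g w : measurable_fun setT g -> measurable_fun setT w ->
  {ae mu, forall v, 0 <= g v} -> (forall v, 0 <= w v) -> 0 <= moment g w.
Proof.
move=> mg mw g0 w0.
(* [g] is nonnegative only almost everywhere; with |g| in its place the integrand is nonnegative
   everywhere. *)
have -> : moment g w = \int[mu]_v (`|g v| * w v).
  congr fine; apply: ae_eq_integral => //.
  - by apply/measurable_EFinP; exact: measurable_funM.
  - apply/measurable_EFinP; apply: measurable_funM => //.
    exact: measurableT_comp.
  - case: g0 => N [mN N0 sN]; exists N; split => // v /= nv.
    by apply: sN => /= gv; apply: nv => _; rewrite ger0_norm.
by apply: Rintegral_ge0 => v _; rewrite mulr_ge0.
Qed.

Lemma momentB g w1 w2 C : in_L 1 g ->
  measurable_fun setT w1 -> measurable_fun setT w2 ->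
  (forall v, `|w1 v| <= C * (1 + enorm v)) ->
  (forall v, `|w2 v| <= C * (1 + enorm v)) ->
  moment g (fun v => w2 v - w1 v) = moment g w2 - moment g w1.
Proof.
move=> Lg mw1 mw2 h1 h2; rewrite /moment -RintegralB//; last 2 first.
- exact: integrable_moment h2.
- exact: integrable_moment h1.
by apply: eq_Rintegral => v _; rewrite mulrBr.
Qed.

Lemma le_moment g w1 w2 C : in_L 1 g -> {ae mu, forall v, 0 <= g v} ->
  measurable_fun setT w1 -> measurable_fun setT w2 ->
  (forall v, `|w1 v| <= C * (1 + enorm v)) ->
  (forall v, `|w2 v| <= C * (1 + enorm v)) ->
  (forall v, w1 v <= w2 v) -> moment g w1 <= moment g w2.
Proof.
move=> Lg g0 mw1 mw2 h1 h2 w12; have [mg _ _] := in_L1E _ Lg.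
rewrite -subr_ge0 -(momentB _ _ _ C)//; apply: moment_ge0 => //.
- exact: measurable_funB.
- by move=> v; rewrite subr_ge0.
Qed.

Lemma momentZ g w C B : in_L 1 g -> measurable_fun setT w ->
  (forall v, `|w v| <= C * (1 + enorm v)) ->
  moment g (fun v => B * w v) = B * moment g w.
Proof.
move=> Lg mw h; rewrite /moment -RintegralZl//; last exact: integrable_moment h.
by apply: eq_Rintegral => v _; rewrite mulrCA.
Qed.

Lemma norm_moment_le g w1 w2 C : in_L 1 g -> {ae mu, forall v, 0 <= g v} ->
  measurable_fun setT w1 -> measurable_fun setT w2 ->
  (forall v, w2 v <= C * (1 + enorm v)) ->
  (forall v, `|w1 v| <= w2 v) -> `|moment g w1| <= moment g w2.
Proof.
move=> Lg g0 mw1 mw2 h2 w12.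
have h1 v : `|w1 v| <= C * (1 + enorm v) by exact: le_trans (h2 v).
have h2' v : `|w2 v| <= C * (1 + enorm v) by rewrite ger0_norm// (le_trans _ (w12 v)).
rewrite ler_norml; apply/andP; split.
  have -> : - moment g w2 = moment g (fun v => -1 * w2 v).
    by rewrite (momentZ _ _ C)// mulN1r.
  apply: (le_moment _ _ _ C) => //.
  - exact: measurable_funM.
  - by move=> v; rewrite mulN1r normrN.
  - by move=> v; rewrite mulN1r; have := w12 v; rewrite ler_norml => /andP[].
apply: (le_moment _ _ _ C) => // v.
exact: le_trans (ler_norm _) (w12 v).
Qed.

Lemma num_particlesE g : num_particles g = moment g (fun=> 1).
Proof. by apply: eq_Rintegral => v _; rewrite mulr1. Qed.

Lemma le1_growth v : `|1 : R| <= 1 * (1 + enorm v).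
Proof. by rewrite normr1 mul1r lerDl enorm_ge0. Qed.

(** The filter is arbitrary because the lemma is used twice: at interior times, for continuity of
    the moments, and at 0+, for the initial number of particles. *)
Lemma cvg_moment (T : Type) (G : set_system T) (FG : ProperFilter G)
    (F : T -> V -> R) g w C :
  in_L 1 g -> (\forall t \near G, in_L 1 (F t)) -> measurable_fun setT w ->
  (forall v, `|w v| <= C * (1 + enorm v)) ->
  norm_L 1 (F t \- g) @[t --> G] --> 0%E ->
  moment (F t) w @[t --> G] --> moment g w.
Proof.
move=> Lg LF mw wC Fg.
(* The sign of [C] is read off the growth bound at v = 0. As [C] may vanish, the tolerance below is
   e / (C + 1). *)
have C0 : 0 <= C.
  have := le_trans (normr_ge0 _) (wC 0).
  by rewrite pmulr_lge0// ltr_pwDl// enorm_ge0.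
apply/cvgrPdist_le => e e0.
have e1 : 0 < e / (C + 1) by rewrite divr_gt0// ltr_wpDl.
have : \forall t \near G, (norm_L 1 (F t \- g)%R < (e / (C + 1))%:E)%E.
  have h : (0 < (e / (C + 1))%:E)%E by rewrite lte_fin.
  exact: (Fg _ (open_ereal_lt' h)).
move=> small; near=> t.
rewrite distrC -lee_fin.
apply: le_trans (moment_le (F t) g w C _ Lg mw C0 wC) _; first by near: t.
have h : (norm_L 1 (F t \- g)%R <= (e / (C + 1))%:E)%E by apply/ltW; near: t.
apply: le_trans (lee_wpmul2l _ h) _; rewrite ?lee_fin//.
by rewrite mulrCA ler_piMr ?(ltW e0)// ler_pdivrMr ?mul1r ?ltr_wpDl// lerDl.
Unshelve. all: by end_near. Qed.

End Moments.

(** * Cut-offs and their diffusion flux *)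

Section Profiles.
Context {R : realType}.
Implicit Types x y : R.

(** The factor [expR 1] normalises the value at 0 to 1. The function is not constant near 0, so its
    defect from 1 has to be estimated, in [onem_profile_le]. *)
Definition profile x : R := expR 1 * flat 0 (1 - x).
Definition dprofile x : R := - (expR 1 * flat 2 (1 - x)).
Definition ddprofile x : R := expR 1 * (flat 4 (1 - x) - 2 * flat 3 (1 - x)).

Lemma is_derive_onem x : is_derive x 1 (fun y : R => 1 - y) (- 1).
Proof. by have := is_deriveB (is_derive_cst (1 : R) x 1) (is_derive_id x 1); rewrite sub0r. Qed.

Lemma is_derive_flat_onem k x : is_derive x 1 (fun y => flat k (1 - y))
  (- (flat k.+2 (1 - x) - k%:R * flat k.+1 (1 - x))).
Proof.
have := is_derive_comp1 (flat k) (fun y => 1 - y) x 1 _ _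
  (is_derive_flat k (1 - x)) (is_derive_onem x).
by rewrite mulrN1.
Qed.

Lemma is_derive_profile x : is_derive x 1 profile (dprofile x).
Proof.
have := is_deriveZ (expR 1) (is_derive_flat_onem 0 x).
by rewrite mul0r subr0 /GRing.scale/= mulrN.
Qed.

Lemma is_derive_dprofile x : is_derive x 1 dprofile (ddprofile x).
Proof.
have := is_deriveN (is_deriveZ (expR 1) (is_derive_flat_onem 2 x)).
by rewrite /GRing.scale/= mulrN opprK.
Qed.

Lemma smooth_onem : smooth (fun y : R => 1 - y).
Proof.
apply: smoothD; first exact: smooth_cst.
by apply: smoothN => n; apply: Cn_linear => // x; exact: cvg_id.
Qed.

Lemma smooth_profile : smooth profile.
Proof.
apply: smoothM; first exact: smooth_cst.
exact: smooth_comp (smooth_flat 0) smooth_onem.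
Qed.

Lemma smooth_dprofile : smooth dprofile.
Proof.
apply/smoothN/smoothM; first exact: smooth_cst.
exact: smooth_comp (smooth_flat 2) smooth_onem.
Qed.

Lemma smooth_ddprofile : smooth ddprofile.
Proof.
apply: smoothM; first exact: smooth_cst.
apply: smoothD; first exact: smooth_comp (smooth_flat 4) smooth_onem.
apply/smoothN/smoothM; first exact: smooth_cst.
exact: smooth_comp (smooth_flat 3) smooth_onem.
Qed.

Lemma profile_ge0 x : 0 <= profile x.
Proof. by rewrite mulr_ge0 ?expR_ge0// flat_ge0. Qed.

Lemma profile_le1 x : 0 <= x -> profile x <= 1.
Proof.
move=> x0; rewrite /profile /flat subr_gt0; case: ifPn => [x1|]; last by rewrite mulr0.
rewrite expr0 invr1 mul1r -expRD expR_le1 subr_le0 -[leLHS]invr1.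
by rewrite lef_pV2 ?posrE// ?subr_gt0// gerBl.
Qed.

Lemma profile_eq0 x : 1 <= x -> profile x = 0.
Proof. by move=> x1; rewrite /profile flat_le0 ?mulr0// subr_le0. Qed.

Lemma dprofile_eq0 x : 1 <= x -> dprofile x = 0.
Proof. by move=> x1; rewrite /dprofile flat_le0 ?mulr0 ?oppr0// subr_le0. Qed.

Lemma ddprofile_eq0 x : 1 <= x -> ddprofile x = 0.
Proof. by move=> x1; rewrite /ddprofile !flat_le0 ?mulr0 ?subr0 ?mulr0// subr_le0. Qed.

(** The bound is linear in y so that, at y = |v| / r, the defect of the cut-off is paid for by the
    first moment. For y > 1/2 the right side exceeds 1; for y <= 1/2, exp(u) >= 1 + u with u = 1 -
    1/(1 - y^2) reduces it to 1/(1 - y^2) <= 1 + 2 y. *)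
Lemma onem_profile_le y : 0 <= y -> 1 - profile (y ^+ 2) <= 2 * y.
Proof.
move=> y0; have [y2|y2] := leP y 2^-1; last first.
  have := profile_ge0 (y ^+ 2); lra.
have yy : y ^+ 2 <= 4^-1.
  have -> : 4^-1 = 2^-1 ^+ 2 :> R by field.
  by rewrite ler_pXn2r ?nnegrE.
have y1 : 0 < 1 - y ^+ 2 by lra.
rewrite /profile /flat y1 expr0 invr1 mul1r -expRD.
have := expR_ge1Dx (1 - (1 - y ^+ 2)^-1).
have : (1 - y ^+ 2)^-1 <= 1 + 2 * y.
  rewrite -div1r ler_pdivrMr// mulrDl mul1r.
  have : y * y ^+ 2 <= y * 4^-1 by rewrite ler_wpM2l.
  have : y ^+ 2 <= y * 2^-1 by rewrite expr2 ler_wpM2l.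
  nra.
lra.
Qed.

Lemma dprofile_bound : exists2 B, 0 <= B &
  forall x, 0 <= x -> `|dprofile x| <= B /\ `|ddprofile x| <= B.
Proof.
have flatB k x : 0 <= x -> flat k (1 - x) <= (k.+2)`!%:R.
  move=> x0; have [x1|x1] := leP 1 x; first by rewrite flat_le0// subr_le0.
  apply: (le_trans (flat_le k (1 - x))); rewrite ler_piMr// expr_le1//; lra.
pose e : R := expR 1.
(* [flat k (1 - x)] is at most (k+2)! for x >= 0: k = 2 occurs in [dprofile], k = 4 and twice k = 3
   in [ddprofile]. *)
exists (e * (4`!%:R + 6`!%:R + 2 * 5`!%:R)).
  by rewrite mulr_ge0 ?expR_ge0// !addr_ge0// mulr_ge0.
move=> x x0; have := flatB 2 x x0; have := flatB 3 x x0; have := flatB 4 x x0.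
have := flat_ge0 2 (1 - x); have := flat_ge0 3 (1 - x); have := flat_ge0 4 (1 - x).
move=> h4 h3 h2 b4 b3 b2.
split; rewrite ?normrN normrM (ger0_norm (expR_ge0 _)) ler_wpM2l ?expR_ge0//.
  rewrite ger0_norm// (le_trans b2)// -addrA lerDl addr_ge0// mulr_ge0//.
have f4 : 0 <= 4`!%:R :> R by [].
by rewrite ler_norml; apply/andP; split; lra.
Qed.

(** A smooth transition from 0 (for x <= 0) to 1 (for x >= 1). Its derivative is a nonnegative
    kernel of mass one, used for averaging in time. *)
Definition step x : R := flat 0 x / (flat 0 x + flat 0 (1 - x)).
Definition dstep x : R :=
  (flat 2 x * flat 0 (1 - x) + flat 0 x * flat 2 (1 - x))
  * (flat 0 x + flat 0 (1 - x))^-1 ^+ 2.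

Lemma step_den_gt0 x : 0 < flat 0 x + flat 0 (1 - x).
Proof.
have [x0|x0] := ltP 0 x; first by rewrite ltr_wpDr ?flat_ge0// flat_gt0.
by rewrite ltr_wpDl ?flat_ge0// flat_gt0// subr_gt0 (le_lt_trans x0).
Qed.

Lemma smooth_step : smooth step.
Proof.
apply: smoothM; first exact: smooth_flat.
apply: smoothV; first by move=> x; rewrite gt_eqF// step_den_gt0.
apply: smoothD; first exact: smooth_flat.
exact: smooth_comp (smooth_flat 0) smooth_onem.
Qed.

Lemma is_derive_step x : is_derive x 1 step (dstep x).
Proof.
have d0 : flat 0 x + flat 0 (1 - x) != 0 by rewrite gt_eqF// step_den_gt0.
have h1 := is_derive_flat 0 x; have h2 := is_derive_flat_onem 0 x.
have h3 := is_derive_inv (fun x => flat 0 x + flat 0 (1 - x)) x 1 _ d0 (is_deriveD h1 h2).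
have h := is_deriveM h1 h3.
by apply: (is_derive_eq h); rewrite /dstep /GRing.scale/=; field.
Qed.

Lemma dstep_ge0 x : 0 <= dstep x.
Proof. by rewrite mulr_ge0 ?sqr_ge0// addr_ge0// mulr_ge0 ?flat_ge0. Qed.

Lemma step_le0 x : x <= 0 -> step x = 0.
Proof. by move=> x0; rewrite /step (flat_le0 _ x)// mul0r. Qed.

Lemma step_ge1 x : 1 <= x -> step x = 1.
Proof.
move=> x1; rewrite /step (flat_le0 _ (1 - x)) ?subr_le0// addr0 divff//.
by rewrite gt_eqF// flat_gt0// (lt_le_trans ltr01).
Qed.

Lemma dstep_le0 x : x <= 0 -> dstep x = 0.
Proof. by move=> x0; rewrite /dstep !(flat_le0 _ x)// !mul0r addr0 mul0r. Qed.

Lemma dstep_ge1 x : 1 <= x -> dstep x = 0.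
Proof.
move=> x1; rewrite /dstep !(flat_le0 _ (1 - x)) ?subr_le0//.
by rewrite !mulr0 addr0 mul0r.
Qed.

End Profiles.

Section Flux.
Context {R : realType}.
Notation V := (R * R * R)%type.
Notation mu := (@leb3 R).
Implicit Types (v u : V) (A r : R).

Lemma coord_linear i (s : R) v u : coord i (s *: v + u) = s * coord i v + coord i u.
Proof. by rewrite /coord; case: i => [[|[|[|//]]] ?]. Qed.

Lemma coord_ebase (i j : 'I_3) : coord i (ebase j) = (i == j)%:R :> R.
Proof. by rewrite /coord; case: i j => [[|[|[|//]]] ?] [[|[|[|//]]] ?]. Qed.

Lemma continuous_coord i : continuous (@coord R i).
Proof.
move=> v; rewrite /coord; case: i => [[|[|[|//]]] ?] /=.
- apply: (@continuous_comp _ _ _ (fst : V -> R * R) (fst : R * R -> R)); exact: cvg_fst.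
- apply: (@continuous_comp _ _ _ (fst : V -> R * R) (snd : R * R -> R)).
    exact: cvg_fst.
  exact: cvg_snd.
- exact: cvg_snd.
Qed.

Lemma smooth_coord i : smooth (@coord R i).
Proof.
move=> n; apply: Cn_linear; last exact: continuous_coord.
exact: coord_linear.
Qed.

Lemma is_derive_coord i v u : is_derive v u (coord i) (coord i u).
Proof. by apply: is_derive_linear => s y z; exact: coord_linear. Qed.

Lemma enorm_sqrE v :
  enorm v ^+ 2 = coord 0 v * coord 0 v + coord 1 v * coord 1 v + coord 2 v * coord 2 v.
Proof. by rewrite enorm_sqr !big_ord_recr big_ord0 /= add0r. Qed.

Lemma smooth_enorm_sqr : smooth (fun v => enorm v ^+ 2 : R).
Proof.
under eq_fun do rewrite enorm_sqrE.
by apply: smoothD; [apply: smoothD|]; apply: smoothM; exact: smooth_coord.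
Qed.

Lemma is_derive_enorm_sqr v j :
  is_derive v (ebase j) (fun v => enorm v ^+ 2) (2 * coord j v).
Proof.
under eq_fun do rewrite enorm_sqrE.
have h i := is_deriveM (is_derive_coord i v (ebase j)) (is_derive_coord i v (ebase j)).
apply: (is_derive_eq (is_deriveD (is_deriveD (h 0) (h 1)) (h 2))).
rewrite /GRing.scale/= !coord_ebase.
by case: j {h} => [[|[|[|//]]] jlt] /=; rewrite ?mulr1 ?mulr0 ?addr0 ?add0r -mulr2n mulr_natl;
  congr (coord _ _ *+ _); exact/val_inj.
Qed.

Definition kin A v : R := Num.sqrt (A ^+ 2 + enorm v ^+ 2).

Lemma kin_gt0 A v : 0 < A -> 0 < kin A v.
Proof. by move=> A0; rewrite sqrtr_gt0 ltr_pwDl ?exprn_gt0// sqr_ge0. Qed.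

Lemma smooth_kin A : 0 < A -> smooth (kin A).
Proof.
move=> A0; apply: smooth_sqrt.
  by move=> v; rewrite ltr_pwDl ?exprn_gt0// sqr_ge0.
by apply: smoothD; [exact: smooth_cst|exact: smooth_enorm_sqr].
Qed.

Lemma is_derive_kin A v j : 0 < A ->
  is_derive v (ebase j) (kin A) (coord j v / kin A v).
Proof.
move=> A0.
have p : 0 < A ^+ 2 + enorm v ^+ 2 by rewrite ltr_pwDl ?exprn_gt0// sqr_ge0.
have h := is_deriveD (is_derive_cst (A ^+ 2) v (ebase j)) (is_derive_enorm_sqr v j).
apply: (is_derive_eq (is_derive_comp1 Num.sqrt (fun v => A ^+ 2 + enorm v ^+ 2)
  v _ _ _ (is_derive1_sqrt p) h)).
have := kin_gt0 A v A0; rewrite /kin => k0.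
by rewrite add0r; field; rewrite gt_eqF.
Qed.

Lemma kin_le A v : 0 <= A -> kin A v <= A + enorm v.
Proof.
move=> A0; rewrite -[leRHS]ger0_norm ?addr_ge0 ?enorm_ge0//.
rewrite -sqrtr_sqr ler_wsqrtr// sqrrD -addrA lerD2l lerDr.
by rewrite mulrn_wge0// mulr_ge0// enorm_ge0.
Qed.

Lemma enorm_le_kin A v : enorm v <= kin A v.
Proof.
rewrite -[leLHS]ger0_norm ?enorm_ge0// -sqrtr_sqr ler_wsqrtr//.
by rewrite lerDr sqr_ge0.
Qed.

Lemma le_kin A v : 0 <= A -> A <= kin A v.
Proof.
move=> A0; rewrite -[leLHS]ger0_norm// -sqrtr_sqr ler_wsqrtr//.
by rewrite lerDl sqr_ge0.
Qed.

(** Measurability for the product sigma-algebra is reduced to that of [enorm], followed by a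
    continuous function of one real variable. *)
Lemma measurable_radial (f : R -> R) : continuous f ->
  measurable_fun setT (fun v => f (enorm v)).
Proof.
move=> cf; apply: (measurableT_comp _ measurable_enorm).
exact: continuous_measurable_fun.
Qed.

Lemma continuous_kin A : continuous (fun s : R => Num.sqrt (A ^+ 2 + s ^+ 2)).
Proof.
move=> s; apply: continuous_comp; last exact: sqrt_continuous.
by apply: cvgD; [exact: cvg_cst|exact: exprn_continuous].
Qed.

Lemma measurable_kin A : measurable_fun setT (kin A).
Proof. exact: (measurable_radial _ (continuous_kin A)). Qed.

Lemma measurable_kinV A : 0 < A -> measurable_fun setT (fun v => (kin A v)^-1).
Proof.
move=> A0; apply: (measurable_radial (fun s => (Num.sqrt (A ^+ 2 + s ^+ 2))^-1)).
move=> s; apply: cvgV; last exact: continuous_kin.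
by rewrite gt_eqF// sqrtr_gt0 ltr_pwDl ?exprn_gt0// sqr_ge0.
Qed.

(** Squared, because |v|^2 is smooth at v = 0 whereas |v| is not. *)
Definition scaled r v : R := enorm v ^+ 2 / r ^+ 2.

Lemma smooth_scaled r : smooth (scaled r).
Proof. by apply: smoothM; [exact: smooth_enorm_sqr|exact: smooth_cst]. Qed.

Lemma is_derive_scaled r v j :
  is_derive v (ebase j) (scaled r) (2 / r ^+ 2 * coord j v).
Proof.
have h := is_deriveM (is_derive_enorm_sqr v j) (is_derive_cst (r ^- 2) v (ebase j)).
by apply: (is_derive_eq h); rewrite /GRing.scale/= mulr0 add0r; ring.
Qed.

Lemma scaled_ge0 r v : 0 <= scaled r v.
Proof. by rewrite mulr_ge0 ?invr_ge0 ?sqr_ge0. Qed.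

Lemma scaled_ge1 r v : 0 < r -> r <= enorm v -> 1 <= scaled r v.
Proof.
move=> r0 rv; rewrite ler_pdivlMr ?exprn_gt0// mul1r ler_pXn2r ?nnegrE//.
  exact: ltW.
exact: enorm_ge0.
Qed.

Lemma measurable_scaled_comp r (f : R -> R) : continuous f ->
  measurable_fun setT (fun v => f (scaled r v)).
Proof.
move=> cf; apply: (measurable_radial (fun s => f (s ^+ 2 / r ^+ 2))) => s.
apply: (@continuous_comp _ _ _ (fun s : R => s ^+ 2 / r ^+ 2)); last exact: cf.
by apply: cvgM; [exact: exprn_continuous|exact: cvg_cst].
Qed.

Definition cutoff r v : R := profile (scaled r v).

Lemma smooth_cutoff r : smooth (cutoff r).
Proof. exact: smooth_comp smooth_profile (smooth_scaled r). Qed.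

Lemma is_derive_cutoff r v j : is_derive v (ebase j) (cutoff r)
  (dprofile (scaled r v) * (2 / r ^+ 2 * coord j v)).
Proof.
exact: (is_derive_comp1 profile (scaled r) _ _ _ _ (is_derive_profile _) (is_derive_scaled r v j)).
Qed.

Lemma measurable_cutoff r : measurable_fun setT (cutoff r).
Proof. by apply: measurable_scaled_comp; exact: (smooth_profile 0). Qed.

Lemma cutoff_ge0 r v : 0 <= cutoff r v.
Proof. exact: profile_ge0. Qed.

Lemma cutoff_le1 r v : cutoff r v <= 1.
Proof. exact/profile_le1/scaled_ge0. Qed.

Lemma onem_cutoff_le r v : 0 < r -> 1 - cutoff r v <= 2 / r * enorm v.
Proof.
move=> r0; have := onem_profile_le (enorm v / r).
rewrite expr_div_n => /(_ _)/le_trans; apply; first by rewrite divr_ge0 ?enorm_ge0// ltW.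
by rewrite mulrA mulrAC.
Qed.

(** Component j of the diffusion matrix applied to the gradient of [cutoff r], as simplified by
    [diffusion_cutoff]. In this form smoothness and compact support are visible. *)
Definition flux r A (j : 'I_3) v : R :=
  2 / r ^+ 2 * (dprofile (scaled r v) * (coord j v * kin A v)).

Definition dflux r A (j : 'I_3) v : R :=
  2 / r ^+ 2 * (ddprofile (scaled r v) * (2 / r ^+ 2) * coord j v ^+ 2 * kin A v
     + dprofile (scaled r v) * (kin A v + coord j v ^+ 2 * (kin A v)^-1)).

(* [v] is an eigenvector of the diffusion matrix: [D v = kin A v *: v]. *)
Lemma diffusion_cutoff r A j v : 0 < A ->
  \sum_(i < 3) diffusion A i j v * (dprofile (scaled r v) * (2 / r ^+ 2 * coord i v))
  = flux r A j v.
Proof.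
move=> A0.
have k0 : kin A v != 0 by rewrite gt_eqF// kin_gt0.
have k2 : kin A v ^+ 2 = A ^+ 2 + enorm v ^+ 2.
  by rewrite sqr_sqrtr// addr_ge0// sqr_ge0.
transitivity (2 / r ^+ 2 * dprofile (scaled r v) / kin A v *
    \sum_(i < 3) (A ^+ 2 * (i == j)%:R + coord i v * coord j v) * coord i v).
  rewrite big_distrr/=; apply: eq_bigr => i _.
  by rewrite /diffusion -/(kin A v); ring.
have -> : \sum_(i < 3) (A ^+ 2 * (i == j)%:R + coord i v * coord j v) * coord i v
    = coord j v * kin A v ^+ 2.
  rewrite k2 enorm_sqr mulrDr big_distrr/=.
  under eq_bigr do rewrite mulrDl.
  rewrite big_split/=; congr (_ + _); last by apply: eq_bigr => i _; ring.
  rewrite (bigD1 j)//= eqxx mulr1 big1 ?addr0 1?mulrC// => i /negbTE ->.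
  by rewrite mulr0 mul0r.
by rewrite /flux; set c := 2 / _; field.
Qed.

Lemma is_derive_flux r A j v : 0 < A ->
  is_derive v (ebase j) (flux r A j) (dflux r A j v).
Proof.
move=> A0.
have h1 := is_derive_comp1 dprofile (scaled r) _ _ _ _ (is_derive_dprofile (scaled r v))
  (is_derive_scaled r v j).
have h2 := is_deriveM (is_derive_coord j v (ebase j)) (is_derive_kin A v j A0).
have h := is_deriveZ (2 / r ^+ 2) (is_deriveM h1 h2).
apply: (is_derive_eq h); rewrite /dflux /GRing.scale/= coord_ebase eqxx/= mulr1n.
have -> : (coord j * kin A) v = coord j v * kin A v by [].
ring.
Qed.

Lemma smooth_flux r A j : 0 < A -> smooth (flux r A j).
Proof.
move=> A0; apply: smoothM; first exact: smooth_cst.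
apply: smoothM; first exact: smooth_comp smooth_dprofile (smooth_scaled r).
by apply: smoothM; [exact: smooth_coord|exact: smooth_kin].
Qed.

Lemma measurable_flux r A j : measurable_fun setT (flux r A j).
Proof.
apply: measurable_funM => //; apply: measurable_funM.
  by apply: measurable_scaled_comp; exact: (smooth_dprofile 0).
by apply: measurable_funM; [exact: measurable_coord|exact: measurable_kin].
Qed.

Lemma measurable_dflux r A j : 0 < A -> measurable_fun setT (dflux r A j).
Proof.
move=> A0; apply: measurable_funM => //; apply: measurable_funD.
  apply: measurable_funM; last exact: measurable_kin.
  apply: measurable_funM; last by apply: measurable_funX; exact: measurable_coord.
  apply: measurable_funM => //.
  by apply: measurable_scaled_comp; exact: (smooth_ddprofile 0).
apply: measurable_funM.
  by apply: measurable_scaled_comp; exact: (smooth_dprofile 0).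
apply: measurable_funD; first exact: measurable_kin.
apply: measurable_funM; last exact: measurable_kinV.
by apply: measurable_funX; exact: measurable_coord.
Qed.

Lemma flux_eq0 r A j v : 0 < r -> r <= enorm v -> flux r A j v = 0.
Proof.
move=> r0 rv; have := scaled_ge1 r v r0 rv => q1.
by rewrite /flux dprofile_eq0// mul0r mulr0.
Qed.

Lemma cutoff_eq0 r v : 0 < r -> r <= enorm v -> cutoff r v = 0.
Proof. by move=> r0 rv; rewrite /cutoff profile_eq0// scaled_ge1. Qed.

(** Both derivatives of the profile vanish for |v| >= r. For |v| < r, kin <= A + r and v_j^2 <= r^2,
    so the bracket in [dflux] is at most 4 B (A + r); the prefactor 2 / r^2 makes the whole of order
    1/r. *)
Lemma dflux_bound r A j v B : 0 < r -> 0 < A -> 0 <= B ->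
  (forall x, 0 <= x -> `|dprofile x| <= B /\ `|ddprofile x| <= B) ->
  `|dflux r A j v| <= 8 * B * (A + r) / r ^+ 2.
Proof.
move=> r0 A0 B0 hB.
have rhs0 : 0 <= 8 * B * (A + r) / r ^+ 2.
  by rewrite !mulr_ge0// ?invr_ge0 ?sqr_ge0// addr_ge0// ltW.
have [rv|vr] := leP r (enorm v).
  have q1 := scaled_ge1 r v r0 rv.
  by rewrite /dflux dprofile_eq0// ddprofile_eq0// !mul0r addr0 mulr0 normr0.
have [h1 h2] := hB _ (scaled_ge0 r v).
have k0 := kin_gt0 A v A0.
have kr : kin A v <= A + r.
  by rewrite (le_trans (kin_le A v (ltW A0)))// lerD2l ltW.
have c2 : coord j v ^+ 2 <= r ^+ 2.
  by rewrite -[leLHS]real_normK ?num_real// ler_pXn2r ?nnegrE// ?(ltW r0)//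
    (le_trans (coord_le_enorm _ _))// ltW.
have ck : coord j v ^+ 2 * (kin A v)^-1 <= kin A v.
  rewrite ler_pdivrMr// -expr2 -[leLHS]real_normK ?num_real// ler_pXn2r ?nnegrE//.
    exact: le_trans (coord_le_enorm _ _) (enorm_le_kin _ _).
  exact: ltW.
rewrite /dflux normrM ger0_norm ?divr_ge0 ?sqr_ge0//.
have -> : 8 * B * (A + r) / r ^+ 2 = 2 / r ^+ 2 * (4 * B * (A + r)).
  by field; rewrite gt_eqF.
rewrite ler_wpM2l ?divr_ge0 ?sqr_ge0//.
apply: (@le_trans _ _ (B * 2 * kin A v + B * (kin A v + kin A v))); last first.
  have := ler_wpM2l B0 kr; lra.
rewrite (le_trans (ler_normD _ _))// lerD//.
  rewrite normrM (ger0_norm (ltW k0)) ler_wpM2r ?(ltW k0)//.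
  rewrite -mulrA normrM ler_pM//.
  rewrite ger0_norm; last by rewrite mulr_ge0 ?divr_ge0 ?sqr_ge0.
  by rewrite mulrAC ler_pdivrMr ?exprn_gt0// ler_wpM2l.
have c0 : 0 <= coord j v ^+ 2 * (kin A v)^-1.
  by rewrite mulr_ge0 ?sqr_ge0// invr_ge0 ltW.
by rewrite normrM ler_pM// ger0_norm ?lerD2l// addr_ge0// ltW.
Qed.

(** A product, so that compactness, measurability and finite measure are checked factor by factor.
    It contains the Euclidean ball of radius r, outside which [cutoff] and [flux] vanish. *)
Definition box r : set V := (`[- r, r] `*` `[- r, r]) `*` `[- r, r].

Lemma compact_box r : compact (box r).
Proof. by do 2?[apply: compact_setX]; exact: segment_compact. Qed.

Lemma enorm_gt_box r v : ~ box r v -> r <= enorm v.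
Proof.
move=> nb; rewrite leNgt; apply/negP => vr; apply: nb.
have h i : coord i v \in `[- r, r].
  by rewrite in_itv/= -ler_norml; apply: (le_trans (coord_le_enorm i v)); exact: ltW.
by split; [split|]; [exact: (h 0)|exact: (h 1)|exact: (h 2)].
Qed.

Lemma measurable_box r : measurable (box r).
Proof. by apply: measurableX; [apply: measurableX|]; exact: measurable_itv. Qed.

Lemma box_lty r : (mu (box r) < +oo)%E.
Proof.
pose l := @lebesgue_measure R; pose I : set R := `[- r, r]%classic.
have mI : measurable I by exact: measurable_itv.
have E1 := @product_measure1E _ _ _ _ R l l I I mI mI.
have E2 := @product_measure1E _ _ _ _ R (l \x l)%E l (I `*` I) I (measurableX mI mI) mI.
have lI : l I \is a fin_num.
  rewrite /l /I lebesgue_measure_itv/=.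
  by case: ifP => _; rewrite -?EFinN -?EFinD.
have -> : mu (box r) = (l I * l I * l I)%E.
  rewrite -E1; exact: E2.
by rewrite ltey_eq !fin_numM.
Qed.

Lemma test_function_flux r A j : 0 < r -> 0 < A ->
  test_function setT (flux r A j).
Proof.
move=> r0 A0; split; first exact: smooth_flux.
exists (box r); split => //; first exact: compact_box.
by move=> v /enorm_gt_box; exact: flux_eq0.
Qed.

Lemma bounded_flux r A j : 0 < r -> 0 < A ->
  exists2 C, 0 <= C & forall v, `|flux r A j v| <= C.
Proof.
move=> r0 A0; have [B B0 hB] := @dprofile_bound R.
exists (2 / r ^+ 2 * (B * (r * (A + r)))).
  by rewrite !mulr_ge0// ?invr_ge0 ?sqr_ge0 ?addr_ge0// ltW.
move=> v; have [rv|vr] := leP r (enorm v).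
  rewrite flux_eq0// normr0 !mulr_ge0// ?invr_ge0 ?sqr_ge0 ?addr_ge0// ltW//.
have [h1 _] := hB _ (scaled_ge0 r v).
rewrite /flux normrM ger0_norm ?divr_ge0 ?sqr_ge0// ler_wpM2l ?divr_ge0 ?sqr_ge0//.
rewrite normrM ler_pM// normrM ler_pM//.
  by rewrite (le_trans (coord_le_enorm _ _))// ltW.
rewrite ger0_norm ?(ltW (kin_gt0 _ _ A0))//.
by rewrite (le_trans (kin_le A v (ltW A0)))// lerD2l ltW.
Qed.

(** Weak derivatives are only square integrable. On the box, which carries the flux and has finite
    measure, |h| <= h^2 + 1. *)
Lemma integrable_mul_flux r A j h : 0 < r -> 0 < A -> h \in Lfun mu 2%:E ->
  mu.-integrable setT (EFin \o (fun v => h v * flux r A j v)).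
Proof.
move=> r0 A0 Lh; have [C C0 hC] := bounded_flux r A j r0 A0.
have mh : measurable_fun setT h by move: Lh; rewrite inE => /andP[/[!inE]/=].
have i1 := Lfun2_integrable_sqr Lh.
have i2 : mu.-integrable setT (EFin \o (\1_(box r) : V -> R)).
  apply/integrableP; split.
    by apply/measurable_EFinP; apply: measurable_indic; exact: measurable_box.
  under eq_integral do rewrite /= ger0_norm//.
  by rewrite integral_indic// ?setIT; [exact: box_lty|exact: measurable_box].
have i3 := integrableZl measurableT C (integrableD measurableT i1 i2).
apply: (le_integrable measurableT _ _ i3).
  apply/measurable_EFinP; apply: measurable_funM => //; exact: measurable_flux.
move=> v _ /=; rewrite lee_fin.
have rhs : 0 <= C * (h v ^+ 2 + \1_(box r) v) by rewrite mulr_ge0// addr_ge0// sqr_ge0.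
rewrite (ger0_norm rhs).
have [bv|bv] := pselect (box r v); last first.
  by rewrite flux_eq0 ?mulr0 ?normr0//; exact: enorm_gt_box.
rewrite indicE mem_set//= normrM mulrC ler_pM//.
have : 0 <= (`|h v| - 1) ^+ 2 by rewrite sqr_ge0.
have : 0 <= `|h v| ^+ 2 by rewrite sqr_ge0.
rewrite -[h v ^+ 2]real_normK ?num_real//; nra.
Qed.

End Flux.

(** * Conservation of the number of particles *)

Section UnmeasurableBound.
Context d (T : measurableType d) (R : realType) (m : {measure set T -> \bar R}).

(** The integral of a nonnegative function is a supremum over the simple functions below it, and a
    larger function has more of them. *)
Lemma le_integral_unmeasurable (f g : T -> \bar R) :
  (forall x, 0 <= f x)%E -> (forall x, f x <= g x)%E ->
  (\int[m]_x f x <= \int[m]_x g x)%E.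
Proof.
move=> f0 fg; have g0 x : (0 <= g x)%E by exact: le_trans (fg x).
rewrite !ge0_integralTE//; apply: ereal_sup_le => _ [h hf <-].
by exists h => // x; exact: le_trans (fg x).
Qed.

(* No measurability: the integrand on the right-hand side of the weak
   Fokker-Planck equation need not be shown measurable in time. *)
Lemma norm_Rintegral_le (D A : set T) (f : T -> R) (M : R) :
  measurable A -> (m A < +oo)%E -> 0 <= M ->
  (forall x, D x -> A x -> `|f x| <= M) -> (forall x, D x -> ~ A x -> f x = 0) ->
  `|\int[m]_(x in D) f x| <= M * fine (m A).
Proof.
move=> mA Afin M0 fM f0; rewrite Rintegral_mkcond.
pose g : T -> \bar R := fun x => ((f \_ D) x)%:E.
have -> : \int[m]_x (f \_ D) x = fine (\int[m]_x g x) by [].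
(* The integrals of the positive and negative parts both lie between 0 and M m(A), so their
   difference is bounded by M m(A), without a factor 2. *)
rewrite integralE.
pose b := fun x => (M * \1_A x)%:E.
have ib : (\int[m]_x b x = (M * fine (m A))%:E)%E.
  rewrite /b; under eq_integral do rewrite EFinM.
  rewrite ge0_integralZl//; last first.
    by apply/measurable_EFinP; exact: measurable_indic.
  rewrite integral_indic// setIT EFinM fineK// ge0_fin_numE//.
have gb x : (`|g x| <= b x)%E.
  rewrite /g /b /= patchE; case: ifPn => [|_]; last by rewrite normr0 lee_fin mulr_ge0.
  rewrite inE => Dx; rewrite lee_fin indicE.
  have [Ax|nAx] := pselect (A x); first by rewrite mem_set//= mulr1 fM.
  by rewrite memNset//= mulr0 f0// normr0.
have hp : (0 <= \int[m]_x g^\+ x <= (M * fine (m A))%:E)%E.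
  rewrite integral_ge0//= -ib le_integral_unmeasurable// => x.
  by rewrite (le_trans _ (gb x))// funeposE maxEle; case: ifP => // _; rewrite lee_abs.
have hn : (0 <= \int[m]_x g^\- x <= (M * fine (m A))%:E)%E.
  rewrite integral_ge0//= -ib le_integral_unmeasurable// => x.
  rewrite (le_trans _ (gb x))// funenegE maxEle; case: ifP => // _.
  by rewrite -abseN lee_abs.
move: hp hn; case: (\int[m]_x g^\+ x)%E => [x||]//=; rewrite ?leye_eq//; last by case/andP.
case: (\int[m]_x g^\- x)%E => [y||]//=; rewrite ?leye_eq//; last by move=> _ /andP[].
rewrite !lee_fin => /andP[x0 xM] /andP[y0 yM].
by rewrite ler_norml; apply/andP; split; lra.
Qed.

End UnmeasurableBound.

(** * Functions of time and velocity *)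

Section SpaceTime.
Context {R : realType} {E : normedModType R}.

Lemma Cn_fst n (f : R -> R) : Cn n f -> Cn n (fun p : R * E => f p.1).
Proof.
move=> Cf; apply: Cn_comp => //; apply: Cn_linear => // p; exact: cvg_fst.
Qed.

(** The two difference quotients are convertible, since the projection of p + h u is the projection
    of p plus h times that of u. *)
Lemma is_derive_snd (f : E -> R) (p u : R * E) df :
  is_derive p.2 u.2 f df -> is_derive p u (fun p : R * E => f p.2) df.
Proof. by case=> d1 d2; split. Qed.

(** [Cn_comp] composes with an outer function of one real variable; here the outer function lives on
    [E], hence a separate induction. *)
Lemma Cn_snd n (f : E -> R) : Cn n f -> Cn n (fun p : R * E => f p.2).
Proof.
elim: n f => [|n IH] f Cf.
  by move=> p; apply: continuous_comp; [exact: cvg_snd|exact: Cf].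
apply: (@CnS_is_derive _ _ n _ (fun u p => 'D_u.2 f p.2)).
- by move=> p; apply: continuous_comp; [exact: cvg_snd|exact: (Cn_continuous n.+1 f Cf)].
- by move=> p u; apply: is_derive_snd; exact: (Cn_is_derive n).
- by move=> u; apply: (IH ('D_u.2 f)); have [_ _] := Cf; apply.
Qed.

Lemma is_derive_fst (f : R -> R) (p u : R * E) df :
  is_derive p.1 u.1 f df -> is_derive p u (fun p : R * E => f p.1) df.
Proof. by case=> d1 d2; split. Qed.

End SpaceTime.

Section WeakFlux.
Context {R : realType}.
Notation V := (R * R * R)%type.
Notation mu := (@leb3 R).
Implicit Types (v : V) (g : V -> R) (A r : R).

Lemma weak_derivP i g : in_H1 g -> is_weak_deriv i g (weak_deriv i g).
Proof. by case=> _ /(_ i) [h hh]; rewrite /weak_deriv; exact: (xgetPex _ (ex_intro _ h hh)). Qed.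

(** The second integration by parts, with [flux r A j] as test function. Estimating the left side
    directly would give no decay: the flux is of order one on a ball of radius r and the weak
    derivatives are only in L^2. After the transfer only moments of [g] itself remain. *)
Lemma weak_flux g A r : in_X g -> 0 < r -> 0 < A ->
  \int[mu]_v (\sum_(j < 3) weak_deriv j g v * flux r A j v) =
  - \sum_(j < 3) moment g (dflux r A j).
Proof.
move=> [_ Hg] r0 A0.
have intg j : mu.-integrable setT (EFin \o (fun v => weak_deriv j g v * flux r A j v)).
  by apply: integrable_mul_flux => //; case: (weak_derivP j g Hg).
have each j : \int[mu]_v (weak_deriv j g v * flux r A j v) = - moment g (dflux r A j).
  have [_ /(_ _ (test_function_flux r A j r0 A0))] := weak_derivP j g Hg.
  move=> /(congr1 (@GRing.opp R)); rewrite opprK => <-; congr (- _).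
  by apply: eq_Rintegral => v _; have [_ ->] := is_derive_flux r A j v A0.
under eq_Rintegral do rewrite !big_ord_recr big_ord0 /= add0r.
rewrite RintegralD//; last by apply: (integrableD measurableT (intg _) (intg _)).
rewrite RintegralD// !each !big_ord_recr big_ord0 /= add0r.
by rewrite !opprD.
Qed.

Lemma norm_weak_flux_le g A r B : in_X g -> {ae mu, forall v, 0 <= g v} ->
  0 < r -> 0 < A -> 0 <= B ->
  (forall x : R, 0 <= x -> `|dprofile x| <= B /\ `|ddprofile x| <= B) ->
  `|\int[mu]_v (\sum_(j < 3) weak_deriv j g v * flux r A j v)| <=
  3 * (8 * B * (A + r) / r ^+ 2 * num_particles g).
Proof.
move=> Xg g0 r0 A0 B0 hB; rewrite weak_flux// normrN.
have Lg := Xg.1.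
have K0 : 0 <= 8 * B * (A + r) / r ^+ 2.
  by rewrite !mulr_ge0// ?invr_ge0 ?sqr_ge0// addr_ge0// ltW.
have each j : `|moment g (dflux r A j)| <= 8 * B * (A + r) / r ^+ 2 * num_particles g.
  rewrite num_particlesE -(momentZ _ _ 1)//; last exact: le1_growth.
  apply: (norm_moment_le _ _ _ (8 * B * (A + r) / r ^+ 2)) => //.
  - exact: measurable_dflux.
  - by move=> v; rewrite ler_wpM2l// lerDl enorm_ge0.
  - by move=> v; rewrite mulr1; exact: dflux_bound.
rewrite (le_trans (ler_norm_sum _ _ _))// (le_trans (ler_sum _ (fun j _ => each j)))//.
by rewrite sumr_const card_ord [leRHS]mulr_natl lexx.
Qed.

End WeakFlux.

Section Bounds.
Context {R : realType}.

Lemma near_time_interval (T : \bar R) t : time_interval T t ->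
  \forall s \near t, time_interval T s.
Proof.
move=> [t0 tT]; near=> s; split; first by near: s; exact: lt_nbhsr.
by near: s; apply: open_nbhs_nbhs; split => //; exact: open_ereal_lt.
Unshelve. all: by end_near. Qed.

Lemma continuous_itv_bounded (f : R -> R) p q : p <= q ->
  (forall t, t \in `[p, q] -> {for t, continuous f}) ->
  exists2 K, 0 <= K & forall t, t \in `[p, q] -> `|f t| <= K.
Proof.
move=> pq cf.
have wf : {within `[p, q], continuous (fun t => `|f t|)}.
  apply: continuous_in_subspaceT => t; rewrite inE/= => tpq.
  by apply: continuous_comp; [exact: cf|exact: norm_continuous].
have [c cpq fc] := EVT_max pq wf.
by exists `|f c|.
Qed.

(** * Averages over short time intervals *)

Section Average.
Variables (s e : R).
Hypothesis e_gt0 : 0 < e.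

(** The difference of two such steps is an admissible cut-off in time, and its derivative compares
    the averages over two short intervals. *)
Definition shift_step (t : R) : R := step ((t - s) / e).
Definition dshift_step (t : R) : R := dstep ((t - s) / e) * e^-1.

Lemma smooth_shift_step : smooth shift_step.
Proof.
apply: (smooth_comp step (fun t : R => (t - s) / e)); first exact: smooth_step.
apply: smoothM; last exact: smooth_cst.
apply: smoothD; last exact: smooth_cst.
by move=> n; apply: Cn_linear => // x; exact: cvg_id.
Qed.

Lemma is_derive_shift_step (t : R) : is_derive t 1 shift_step (dshift_step t).
Proof.
have h : is_derive t 1 (fun t : R => (t - s) / e) e^-1.
  have h1 := is_deriveB (is_derive_id t 1) (is_derive_cst s t 1).
  have := is_deriveM h1 (is_derive_cst e^-1 t 1).
  by rewrite subr0 scaler0 add0r /GRing.scale/= mulr1.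
exact: (is_derive_comp1 step (fun t : R => (t - s) / e) _ _ _ _ (is_derive_step _) h).
Qed.

Lemma dshift_step_ge0 t : 0 <= dshift_step t.
Proof. by rewrite mulr_ge0 ?dstep_ge0// invr_ge0 ltW. Qed.

Lemma continuous_dshift_step : continuous dshift_step.
Proof.
have -> : dshift_step = 'D_1 shift_step.
  by apply/funext => t; case: (is_derive_shift_step t).
by have [_ _ /(_ 1)] := smooth_shift_step 1.
Qed.

Lemma shift_step_le t : t <= s -> shift_step t = 0.
Proof.
by move=> ts; rewrite /shift_step step_le0// pmulr_lle0 ?invr_gt0// subr_le0.
Qed.

Lemma shift_step_ge t : s + e <= t -> shift_step t = 1.
Proof.
by move=> ts; rewrite /shift_step step_ge1// ler_pdivlMr// mul1r lerBrDl.
Qed.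

Lemma dshift_step_eq0 t : t \notin `[s, s + e] -> dshift_step t = 0.
Proof.
rewrite in_itv/= negb_and -!ltNge /dshift_step => /orP[|] ts.
  by rewrite dstep_le0 ?mul0r// pmulr_lle0 ?invr_gt0// subr_le0 ltW.
by rewrite dstep_ge1 ?mul0r// ler_pdivlMr// mul1r lerBrDl ltW.
Qed.

(** The kernel is nonnegative and has integral one by the fundamental theorem of calculus, so
    averaging values within d of c stays within d of c. The larger interval [p, q] lets averages at
    two different times share one domain. *)
Lemma average_shift_step (n : R -> R) p q c d :
  p <= s -> s + e <= q -> (forall t, t \in `[p, q] -> {for t, continuous n}) ->
  (forall t, t \in `[s, s + e] -> `|n t - c| <= d) ->
  `|\int[@lebesgue_measure R]_(t in `[p, q]) (dshift_step t * n t) - c| <= d.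
Proof.
move=> ps sq cn nc.
have pq : p < q by rewrite (le_lt_trans ps)// (lt_le_trans _ sq)// ltrDl.
have int (f : R -> R) : (forall t, t \in `[p, q] -> {for t, continuous f}) ->
    (@lebesgue_measure R).-integrable `[p, q] (EFin \o f).
  move=> cf; apply: continuous_compact_integrable; first exact: segment_compact.
  by apply: continuous_in_subspaceT => t; rewrite inE/=; exact: cf.
have cD := continuous_dshift_step.
have int1 : \int[@lebesgue_measure R]_(t in `[p, q]) dshift_step t = 1.
  have cS t : {for t, continuous shift_step} by exact: (smooth_shift_step 0).
  rewrite /Rintegral (continuous_FTC2 (F := shift_step))//.
  - by rewrite shift_step_ge// shift_step_le// sube0.
  - exact: continuous_subspaceT.
  - split.
    + by move=> t _; case: (is_derive_shift_step t).
    + by apply: cvg_at_right_filter; exact: cS.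
    + by apply: cvg_at_left_filter; exact: cS.
  - by move=> t _; rewrite derive1E; case: (is_derive_shift_step t).
have cDn t : t \in `[p, q] -> {for t, continuous (fun t => dshift_step t * n t)}.
  by move=> tpq; apply: cvgM; [exact: cD|exact: cn].
have cDc x t : t \in `[p, q] -> {for t, continuous (fun t => dshift_step t * x)}.
  by move=> tpq; apply: cvgM; [exact: cD|exact: cvg_cst].
have E x : \int[@lebesgue_measure R]_(t in `[p, q]) (dshift_step t * x) = x.
  rewrite RintegralZr//; first by rewrite int1 mul1r.
  by apply: int => t _; exact: cD.
have h t : t \in `[p, q] -> `|dshift_step t * n t - dshift_step t * c| <= dshift_step t * d.
  move=> tpq; rewrite -mulrBr normrM ger0_norm ?dshift_step_ge0//.
  have [ts|ts] := boolP (t \in `[s, s + e]).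
    by rewrite ler_wpM2l ?dshift_step_ge0// nc.
  by rewrite dshift_step_eq0// !mul0r.
rewrite -[X in _ - X](E c) -RintegralB//; [|exact: (int _ cDn)|exact: (int _ (cDc c))].
rewrite ler_norml.
apply/andP; split.
  rewrite -[X in X <= _](E (- d)); apply: le_Rintegral => //; [exact: (int _ (cDc _))| |].
    by apply: int => t tpq; apply: cvgB; [exact: cDn|exact: cDc].
  by move=> t /h; rewrite ler_norml mulrN => /andP[].
rewrite -[X in _ <= X](E d); apply: le_Rintegral => //; [ |exact: (int _ (cDc _))|].
  by apply: int => t tpq; apply: cvgB; [exact: cDn|exact: cDc].
by move=> t /h; rewrite ler_norml => /andP[].
Qed.

End Average.

End Bounds.

Section Conservation.
Context {R : realType}.
Notation V := (R * R * R)%type.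
Notation mu := (@leb3 R).
Notation leb := (@lebesgue_measure R).
Implicit Types (w : V -> R) (v : V) (C r t : R).
Variables (sigma : R) (T : \bar R) (F : R -> V -> R) (a : R -> R).
Let I := time_interval T.
Hypothesis sigma_gt0 : 0 < sigma.
Hypothesis F_cont : continuous_in_X I F.
Hypothesis F_ge0 : forall t, I t -> {ae mu, forall v, 0 <= F t v}.
Hypothesis a_gt0 : forall t, I t -> 0 < a t.
Hypothesis a_cont : forall t, I t -> {for t, continuous a}.
Hypothesis fokker_planck : fokker_planck_weak sigma T F a.

Let F_L t : I t -> in_L 1 (F t).
Proof. by move=> /(F_cont.1 t) []. Qed.

Lemma continuous_moment w C t : I t -> measurable_fun setT w ->
  (forall v, `|w v| <= C * (1 + enorm v)) ->
  {for t, continuous (fun s => moment (F s) w)}.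
Proof.
move=> It mw wC; apply: (@cvg_moment R R (nbhs t) _ F (F t) w C) => //; first exact: F_L.
  by near=> s; apply: F_L; near: s; exact: near_time_interval.
have Fc := F_cont.2 t It.
apply: (squeeze_cvge _ (cvg_cst 0%E) Fc).
near=> s; apply/andP; split.
  by rewrite /norm_L !adde_ge0// Lnorm_ge0.
by rewrite /norm_X leeDl// /norm_H1 adde_ge0// ?Lnorm_ge0// sume_ge0// => i _; exact: Lnorm_ge0.
Unshelve. all: by end_near. Qed.

Lemma continuous_particles t : I t ->
  {for t, continuous (fun s => num_particles (F s))}.
Proof.
move=> It; under [X in {for _, continuous X}]eq_fun do rewrite num_particlesE.
by apply: (continuous_moment _ 1) => //; exact: le1_growth.
Qed.

Section Tested.
Variables (chi dchi : R -> R) (p q : R).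
Hypothesis chi_smooth : smooth chi.
Hypothesis chi_deriv : forall t : R, is_derive t 1 chi (dchi t).
Hypothesis dchi_cont : continuous dchi.
Hypothesis p_gt0 : 0 < p.
Hypothesis pq : p <= q.
Hypothesis Iq : I q.
Hypothesis chi0 : forall t, t \notin `[p, q] -> chi t = 0.

Let I_itv t : t \in `[p, q] -> I t.
Proof.
rewrite in_itv/= => /andP[pt tq]; apply: time_interval_le Iq _ tq.
exact: lt_le_trans pt.
Qed.

Let dchi0 t : t \notin `[p, q] -> dchi t = 0.
Proof.
move=> tpq; have [_ <-] := chi_deriv t.
have -> : 0 = 'D_1 (cst (0 : R)) t :> R by rewrite derive_cst.
apply: near_eq_derive.
have nt : \forall s \near t, (~` `[p, q]%classic) s.
  apply: open_nbhs_nbhs; split; last exact/negP.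
  by apply: closed_openC; exact: itv_closed.
near=> s; apply: chi0; apply/negP.
by near: s; exact: nt.
Unshelve. all: by end_near. Qed.

Let psi r : R * V -> R := fun z => chi z.1 * cutoff r z.2.

Let test_psi r : 0 < r -> test_function (I `*` setT) (psi r).
Proof.
move=> r0; split.
  move=> n; apply: CnM; first by apply: Cn_fst; exact: chi_smooth.
  by apply: Cn_snd; exact: smooth_cutoff.
exists (`[p, q]%classic `*` box r); split.
- by apply: compact_setX; [exact: segment_compact|exact: compact_box].
- by move=> [t v] [/= tpq _]; split => //; exact: I_itv.
- move=> [t v] /= nK; rewrite /psi/=.
  have [tpq|tpq] := boolP (t \in `[p, q]); last by rewrite chi0// mul0r.
  rewrite cutoff_eq0 ?mulr0//; apply: enorm_gt_box => bv; exact: nK.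
Qed.

Let psi_t r t v : 'D_((1 : R), (0 : V)) (psi r) (t, v) = dchi t * cutoff r v.
Proof.
have h1 : is_derive (t, v) ((1 : R), (0 : V)) (fun z : R * V => chi z.1) (dchi t).
  exact: is_derive_fst.
have h2 : is_derive (t, v) ((1 : R), (0 : V)) (fun z : R * V => cutoff r z.2) 0.
  by apply: is_derive_snd; exact: is_derive0.
have [_ ->] := is_deriveM h1 h2.
by rewrite /GRing.scale/= mulr0 add0r mulrC.
Qed.

Let psi_v r t v i : 'D_((0 : R), ebase i) (psi r) (t, v) =
  chi t * (dprofile (scaled r v) * (2 / r ^+ 2 * coord i v)).
Proof.
have h1 : is_derive (t, v) ((0 : R), (ebase i : V)) (fun z : R * V => chi z.1) 0.
  by apply: is_derive_fst; exact: is_derive0.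
have h2 := is_derive_snd (cutoff r) (t, v) ((0 : R), ebase i) _ (is_derive_cutoff r v i).
have [_ ->] := is_deriveM h1 h2.
by rewrite /GRing.scale/= mulr0 addr0.
Qed.

Let restrict_itv (f : R -> R) : (forall t, t \notin `[p, q] -> f t = 0) ->
  \int[leb]_(t in I) f t = \int[leb]_(t in `[p, q]) f t.
Proof.
move=> f0; rewrite Rintegral_mkcond [RHS]Rintegral_mkcond.
apply: eq_Rintegral => t _; rewrite !patchE.
have [tpq|tpq] := boolP (t \in `[p, q]).
  by rewrite !mem_set//; exact: I_itv.
by rewrite f0//; do 2 case: ifP.
Qed.

Let lhsE r : 0 < r ->
  \int[leb]_(t in I) \int[mu]_v (F t v * 'D_((1 : R), (0 : V)) (psi r) (t, v))
  = \int[leb]_(t in `[p, q]) (dchi t * moment (F t) (cutoff r)).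
Proof.
move=> r0.
have h : {in I, (fun t => \int[mu]_v (F t v * 'D_((1 : R), (0 : V)) (psi r) (t, v)))
    =1 (fun t => dchi t * moment (F t) (cutoff r))}.
  move=> t; rewrite inE => It.
  rewrite -(momentZ _ _ 1); [|exact: F_L|exact: measurable_cutoff|].
    by apply: eq_Rintegral => v _; rewrite psi_t.
  move=> v; rewrite mul1r ger0_norm ?cutoff_ge0// (le_trans (cutoff_le1 _ _))//.
  by rewrite lerDl enorm_ge0.
transitivity (\int[leb]_(t in I) (dchi t * moment (F t) (cutoff r))).
  by apply: eq_Rintegral => t tI; exact: h.
apply: restrict_itv => t tpq; by rewrite dchi0// mul0r.
Qed.

Let rhsE r t : 0 < r -> I t ->
  \int[mu]_v (sigma * a t * \sum_(i < 3) \sum_(j < 3)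
      diffusion (a t) i j v * weak_deriv j (F t) v
      * 'D_((0 : R), ebase i) (psi r) (t, v)) =
  sigma * a t * chi t *
  \int[mu]_v (\sum_(j < 3) weak_deriv j (F t) v * flux r (a t) j v).
Proof.
move=> r0 It; have at0 := a_gt0 t It.
rewrite -RintegralZl//; last first.
  have -> : EFin \o (fun v => \sum_(j < 3) weak_deriv j (F t) v * flux r (a t) j v) =
      (fun v => \sum_(j < 3) (weak_deriv j (F t) v * flux r (a t) j v)%:E)%E.
    by apply/funext => v; rewrite /= sumEFin.
  apply: integrable_sum => // j _.
  apply: integrable_mul_flux => //.
  by case: (weak_derivP j (F t) (F_cont.1 t It).2).
apply: eq_Rintegral => v _.
rewrite -[RHS]mulrA; congr (_ * _); rewrite exchange_big/= big_distrr/=.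
apply: eq_bigr => j _; rewrite -diffusion_cutoff// !big_distrr/=.
by apply: eq_bigr => i _; rewrite psi_v; ring.
Qed.

(** The distributional form of dN/dt = 0. Writing 1 = cutoff + (1 - cutoff) splits the integral into
    a part governed by the weak equation and a tail governed by the first moment; both are O(1/r)
    uniformly on [p, q], and r is arbitrary. *)
Lemma particles_tested :
  \int[leb]_(t in `[p, q]) (dchi t * num_particles (F t)) = 0.
Proof.
have mE w C : measurable_fun setT w -> (forall v, `|w v| <= C * (1 + enorm v)) ->
    forall t, t \in `[p, q] -> {for t, continuous (fun s => moment (F s) w)}.
  by move=> mw wC t /I_itv It; exact: continuous_moment wC.
have g1 := @le1_growth R.
have m1 : measurable_fun setT ((fun=> 1) : V -> R) by exact: measurable_cst.
have gE (v : V) : `|enorm v| <= 1 * (1 + enorm v).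
  by rewrite mul1r ger0_norm ?enorm_ge0// lerDr.
have gc r (v : V) : `|cutoff r v| <= 1 * (1 + enorm v).
  rewrite mul1r ger0_norm ?cutoff_ge0// (le_trans (cutoff_le1 _ _))//.
  by rewrite lerDl enorm_ge0.
(* On [p, q], K1 to K5 bound in turn the number of particles, the first moment, [a], [dchi] and
   [chi]. *)
have [K1 K10 nK1] := continuous_itv_bounded _ _ _ pq (mE _ 1 m1 g1).
have [K2 K20 nK2] := continuous_itv_bounded _ _ _ pq (mE _ 1 measurable_enorm gE).
have [K3 K30 nK3] := continuous_itv_bounded _ _ _ pq (fun t tpq => a_cont t (I_itv t tpq)).
have [K4 K40 nK4] := continuous_itv_bounded _ _ _ pq (fun t _ => dchi_cont t).
have [K5 K50 nK5] := continuous_itv_bounded _ _ _ pq (fun t _ => chi_smooth 0 t).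
have [B B0 hB] := @dprofile_bound R.
pose L := fine (leb `[p, q]%classic).
have L0 : 0 <= L by rewrite fine_ge0.
have Lfin : (leb `[p, q]%classic < +oo)%E.
  by rewrite lebesgue_measure_itv/=; case: ifP => // _; rewrite ltry.
(* The first summand comes from the flux, where (a + r) / r^2 <= (K3 + 1) / r because r >= 1; the
   second comes from the tail. *)
pose C := sigma * K3 * K5 * (3 * (8 * B * (K3 + 1) * K1)) * L + K4 * (2 * K2) * L.
have C0 : 0 <= C.
  by rewrite addr_ge0// !mulr_ge0// ?addr_ge0// ltW.
suff main r : 1 <= r ->
    `|\int[leb]_(t in `[p, q]) (dchi t * num_particles (F t))| <= C / r.
  apply/eqP; rewrite -normr_le0; apply/ler_addgt0Pl => e e0; rewrite addr0.
  have r1 : 1 <= Num.max 1 (C / e) by rewrite le_max lexx.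
  have r0 : 0 < Num.max 1 (C / e) by rewrite (lt_le_trans _ r1).
  apply: (le_trans (main _ r1)); rewrite ler_pdivrMr// mulrC -ler_pdivrMr//.
  by rewrite le_max lexx orbT.
move=> r1; have r0 : 0 < r by exact: lt_le_trans r1.
have := fokker_planck (psi r) (test_psi r r0).
rewrite -/I (lhsE r r0) => E.
have int_mom w : measurable_fun setT w -> (forall v, `|w v| <= 1 * (1 + enorm v)) ->
    leb.-integrable `[p, q] (EFin \o (fun t => dchi t * moment (F t) w)).
  move=> mw wC; apply: continuous_compact_integrable; first exact: segment_compact.
  apply: continuous_in_subspaceT => t; rewrite inE/= => tpq.
  by apply: cvgM; [exact: dchi_cont|exact: mE wC t tpq].
have -> : \int[leb]_(t in `[p, q]) (dchi t * num_particles (F t)) =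
   \int[leb]_(t in `[p, q]) (dchi t * moment (F t) (cutoff r)) +
   \int[leb]_(t in `[p, q]) (dchi t * (moment (F t) (fun=> 1) - moment (F t) (cutoff r))).
  under [X in _ + X]eq_Rintegral do rewrite mulrBr.
  rewrite RintegralB//; [|exact: int_mom|apply: int_mom => //; exact: measurable_cutoff].
  by rewrite addrCA subrr addr0; apply: eq_Rintegral => t _; rewrite num_particlesE.
rewrite (le_trans (ler_normD _ _))// /C mulrDl lerD//.
(* By [E] the cut-off part is the flux integral, whose integrand vanishes outside [p, q] together
   with [chi]. *)
- rewrite E mulrAC; apply: norm_Rintegral_le => //.
  + by rewrite !mulr_ge0// ?addr_ge0// ?invr_ge0; exact: ltW.
  + move=> t It tpq; rewrite (rhsE r t r0 It).
    have at0 := a_gt0 t It.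
    rewrite normrM -[leRHS]mulrA ler_pM//.
      rewrite !normrM !(gtr0_norm sigma_gt0) ler_pM//; last exact: nK5.
      by rewrite mulr_ge0// ltW.
      by rewrite ler_wpM2l ?(ltW sigma_gt0)//; exact: nK3.
    apply: (le_trans (norm_weak_flux_le _ _ _ B (F_cont.1 t It) (F_ge0 t It) r0 at0 B0 hB)).
    rewrite -[leRHS]mulrA ler_wpM2l//.
    have nn : num_particles (F t) <= K1.
      by rewrite num_particlesE (le_trans (ler_norm _))// nK1.
    have n0 : 0 <= num_particles (F t).
      by rewrite num_particlesE; apply: moment_ge0 => //; [case: (in_L1E _ (F_L t It))|exact: F_ge0].
    rewrite [leRHS]mulrAC ler_pM//.
      by rewrite !mulr_ge0// ?invr_ge0 ?sqr_ge0// addr_ge0// ltW.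
    have aK : a t <= K3 by rewrite (le_trans (ler_norm _))// nK3.
    rewrite ler_pdivrMr ?exprn_gt0// expr2 mulrA mulfVK ?gt_eqF//.
    rewrite -!mulrA ler_wpM2l// ler_wpM2l// mulrDl mul1r lerD2r.
    by rewrite (le_trans aK)// ler_peMr.
  + move=> t It tpq; rewrite (rhsE r t r0 It).
    by rewrite chi0 ?mulr0 ?mul0r//; exact/negP.
(* The tail: 1 - cutoff <= 2 |v| / r and the first moment is at most K2. *)
- rewrite mulrAC; apply: norm_Rintegral_le => //.
  + by rewrite !mulr_ge0// invr_ge0 ltW.
  + move=> t tpq _; have It := I_itv t tpq.
    rewrite normrM -mulrA ler_pM//; first exact: nK4.
    rewrite -(momentB _ _ _ 1)//; do ?[exact: F_L|exact: measurable_cutoff|exact: gc].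
    apply: (@le_trans _ _ (moment (F t) (fun v => 2 / r * enorm v))).
      apply: (norm_moment_le _ _ _ (2 / r)) => //.
      * exact: F_L.
      * exact: F_ge0.
      * by apply: measurable_funB => //; exact: measurable_cutoff.
      * by apply: measurable_funM => //; exact: measurable_enorm.
      * by move=> v; rewrite ler_wpM2l ?lerDr// divr_ge0// ltW.
      * move=> v; rewrite ger0_norm ?subr_ge0 ?cutoff_le1//.
        exact: onem_cutoff_le.
    rewrite (momentZ _ _ 1)//; do ?[exact: F_L|exact: measurable_enorm].
    rewrite mulrAC ler_wpM2r ?invr_ge0 ?(ltW r0)// ler_wpM2l//.
    by rewrite (le_trans (ler_norm _))// nK2.
Qed.

End Tested.

(** Testing with a step at s1 minus a step at s2 equates the averages of N over [s1, s1 + e] and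
    [s2, s2 + e]. By continuity, for small e each average is within d of the value at its left
    end. *)
Lemma particles_constant s1 s2 : 0 < s1 -> s1 < s2 -> I s2 ->
  num_particles (F s1) = num_particles (F s2).
Proof.
move=> s10 s12 I2; pose n t := num_particles (F t).
have I1 : I s1 by exact: time_interval_le I2 s10 (ltW s12).
suff main d : 0 < d -> `|n s1 - n s2| <= 2 * d.
  apply/eqP; rewrite -subr_eq0 -normr_le0; apply/ler_addgt0Pl => d d0; rewrite addr0.
  by have := main (d / 2); rewrite divr_gt0// => /(_ isT)/le_trans; apply; rewrite mulrC divfK.
move=> d0.
have near_n s : I s -> \forall e \near (0 : R)^'+,
    I (s + e) /\ forall t, t \in `[s, s + e] -> `|n t - n s| <= d.
  move=> Is.
  have h : \forall t \near s, I t /\ `|n t - n s| <= d.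
    near=> t; split; first by near: t; exact: near_time_interval.
    rewrite distrC; near: t.
    by have /cvgrPdist_le := continuous_particles s Is; apply.
  move: h => /nbhs_ballP[x /= x0 hx].
  near=> e.
  have ex : e < x by near: e; exact: nbhs_right_lt.
  have e0 : 0 < e by near: e; exact: nbhs_right_gt.
  have hb t : t \in `[s, s + e] -> ball s x t.
    rewrite in_itv/= => /andP[st te]; rewrite /ball/= distrC ger0_norm ?subr_ge0//.
    by rewrite ltrBlDl (le_lt_trans te)// ltrD2l.
  split; first by apply: (hx _ (hb _ _)).1; rewrite in_itv/= lexx andbT lerDl ltW.
  by move=> t /hb/hx[].
near (0 : R)^'+ => e.
have e0 : 0 < e by near: e; exact: nbhs_right_gt.
have [_ n1] : I (s1 + e) /\ forall t, t \in `[s1, s1 + e] -> `|n t - n s1| <= d.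
  by near: e; exact: near_n.
have [Iq n2] : I (s2 + e) /\ forall t, t \in `[s2, s2 + e] -> `|n t - n s2| <= d.
  by near: e; exact: near_n.
have sq : s1 + e <= s2 + e by rewrite lerD2r ltW.
have pq : s1 <= s2 + e by rewrite (le_trans _ sq)// lerDl ltW.
have It t : t \in `[s1, s2 + e] -> I t.
  rewrite in_itv/= => /andP[pt tq]; apply: time_interval_le Iq _ tq.
  exact: lt_le_trans pt.
have cn t : t \in `[s1, s2 + e] -> {for t, continuous n}.
  by move=> /It; exact: continuous_particles.
have a1 := average_shift_step s1 e e0 n s1 (s2 + e) _ _ (lexx _) sq cn n1.
have a2 := average_shift_step s2 e e0 n s1 (s2 + e) _ _ (ltW s12) (lexx _) cn n2.
have int s : (@lebesgue_measure R).-integrable `[s1, s2 + e]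
    (EFin \o (fun t => dshift_step s e t * n t)).
  apply: continuous_compact_integrable; first exact: segment_compact.
  apply: continuous_in_subspaceT => t; rewrite inE/= => tpq.
  by apply: cvgM; [exact: continuous_dshift_step|exact: cn].
have := @particles_tested (fun t => shift_step s1 e t - shift_step s2 e t)
  (fun t => dshift_step s1 e t - dshift_step s2 e t) s1 (s2 + e) _ _ _ s10 pq Iq _.
have h1 : smooth (fun t => shift_step s1 e t - shift_step s2 e t).
  by apply: smoothD; [exact: smooth_shift_step|exact/smoothN/smooth_shift_step].
have h2 (t : R) : is_derive t 1 (fun t => shift_step s1 e t - shift_step s2 e t)
    (dshift_step s1 e t - dshift_step s2 e t).
  exact: (is_deriveB (is_derive_shift_step s1 e t) (is_derive_shift_step s2 e t)).
have h3 : continuous (fun t => dshift_step s1 e t - dshift_step s2 e t).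
  by move=> t; apply: cvgB; exact: continuous_dshift_step.
have h4 t : t \notin `[s1, s2 + e] -> shift_step s1 e t - shift_step s2 e t = 0.
  rewrite in_itv/= negb_and -!ltNge => /orP[|] ts.
    by rewrite !shift_step_le ?subrr//; [exact: ltW (lt_trans ts s12)|exact: ltW].
  by rewrite !shift_step_ge ?subrr//; [exact: ltW|exact: le_trans sq (ltW ts)].
move=> /(_ h1 h2 h3 h4).
under eq_Rintegral do rewrite mulrBl.
rewrite RintegralB//.
move: a1 a2; set X := Rintegral _ _ _; set Y := Rintegral _ _ _.
rewrite !ler_norml => /andP[x1 x2] /andP[y1 y2] XY.
by apply/andP; split; lra.
Unshelve. all: by end_near. Qed.

(** As s -> 0+ the number of particles is constant by [particles_constant], and it tends to that of
    [F0] by convergence in [norm_L 1]. *)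
Lemma particles_initial F0 : in_L 1 F0 ->
  norm_L 1 (F t \- F0) @[t --> 0^'+] --> 0%E ->
  forall t, I t -> num_particles (F t) = num_particles F0.
Proof.
move=> LF0 Finit t It; have t0 : 0 < t := It.1.
have lim : num_particles (F s) @[s --> 0^'+] --> num_particles F0.
  under eq_cvg do rewrite num_particlesE.
  rewrite num_particlesE.
  apply: (@cvg_moment R R (0^'+) _ F F0 (fun=> 1) 1) => //; last exact: le1_growth.
  near=> s; apply: F_L; apply: time_interval_le It _ _.
    by near: s; exact: nbhs_right_gt.
  by near: s; exact: nbhs_right_le.
have lim2 : num_particles (F s) @[s --> 0^'+] --> num_particles (F t).
  apply: cvg_near_cst; near=> s.
  have s0 : 0 < s by near: s; exact: nbhs_right_gt.
  have st : s < t by near: s; exact: nbhs_right_lt.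
  exact: particles_constant.
exact: cvg_unique lim2 lim.
Unshelve. all: by end_near. Qed.

End Conservation.

(** * The blow-up criterion *)

Section Gauss.
Context {R : realType}.
Notation leb := (@lebesgue_measure R).
Implicit Types x y : R.

Definition gauss_cdf y : R := \int[leb]_(s in `]-oo, y]) gauss_fun s.

Lemma integrable_gauss (D : set R) : measurable D ->
  leb.-integrable D (EFin \o gauss_fun).
Proof. by move=> mD; apply: integrableS (@integrableT_gauss R). Qed.

Lemma is_derive_gauss_cdf x : is_derive x 1 gauss_cdf (gauss_fun x).
Proof.
have x1 : x < x + 1 by rewrite ltrDl.
have [] := @continuous_FTC1 R gauss_fun -oo%O x (x + 1) x1.
- by apply: integrable_gauss; exact: measurable_itv.
- by rewrite ltNyr.
- exact: continuous_gauss_fun.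
- by move=> d1 d2; apply: DeriveDef => //; rewrite -derive1E.
Qed.

(** By monotone convergence a strict inequality for the whole tail already holds on a bounded
    interval; y will fix the finite time t1, and x < y its positivity. *)
Lemma gauss_tail_exceeds x z :
  z < \int[leb]_(s in `[x, +oo[) gauss_fun s ->
  exists2 y, x < y & z < gauss_cdf y - gauss_cdf x.
Proof.
move=> zx.
have mg := @measurable_gauss_fun R.
have tailE : \int[leb]_(s in `[x, +oo[) gauss_fun s =
    \int[leb]_(s in setT) gauss_fun s - gauss_cdf x.
  rewrite -Rintegral_itv_obnd_cbnd; last by apply: integrable_gauss; exact: measurable_itv.
  rewrite -set_itvNyy /gauss_cdf Rintegral_itvB//.
  by apply: integrable_gauss; exact: measurable_itv.
have cv : gauss_cdf n%:R @[n --> \oo] --> \int[leb]_(s in setT) gauss_fun s.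
  apply: fine_cvg.
  have -> : (fine (\int[leb]_s (gauss_fun s)%:E))%:E = (\int[leb]_s (gauss_fun s)%:E)%E.
    rewrite fineK//; apply: integrable_fin_num => //; exact: integrable_gauss.
  have -> : [set: R] = \bigcup_n `]-oo, (n%:R : R)]%classic.
    apply/seteqP; split => // s _; exists (Num.bound `|s|) => //=.
    rewrite in_itv/=; apply/ltW/(le_lt_trans (ler_norm s)).
    exact: archi_boundP.
  apply: ge0_nondecreasing_set_cvg_integral.
  - move=> m n mn; apply/subsetPset => s /=; rewrite !in_itv/= => /le_trans; apply.
    by rewrite ler_nat.
  - by move=> n; exact: measurable_itv.
  - by move=> n; apply/measurable_EFinP; exact: measurable_funTS.
  - by move=> n s _; rewrite lee_fin gauss_fun_ge0.
have zT : z + gauss_cdf x < \int[leb]_(s in setT) gauss_fun s.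
  by rewrite -ltrBrDr -tailE.
near \oo => n.
exists n%:R; last by rewrite ltrBrDr; near: n; exact: (cvgr_gt _ cv).
near: n; exact: nbhs_infty_gtr.
Unshelve. all: by end_near. Qed.

End Gauss.

(** * Bounds on energy density and pressure *)

Section Matter.
Context {R : realType}.
Notation V := (R * R * R)%type.
Notation mu := (@leb3 R).
Implicit Types (g : V -> R) (A : R).

Lemma kin_growth A (v : V) : 0 < A -> `|kin A v| <= (A + 1) * (1 + enorm v).
Proof.
move=> A0; rewrite ger0_norm ?(ltW (kin_gt0 _ _ A0))//.
rewrite (le_trans (kin_le A v (ltW A0)))//.
have := enorm_ge0 v; nra.
Qed.

Lemma energy_density_ge0 A g : 0 < A -> measurable_fun setT g ->
  {ae mu, forall v, 0 <= g v} -> 0 <= energy_density A g.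
Proof.
move=> A0 mg g0; rewrite mulr_ge0 ?invr_ge0 ?exprn_ge0 ?(ltW A0)//.
apply: (moment_ge0 g (kin A)) => //; first exact: measurable_kin.
by move=> v; exact/ltW/kin_gt0.
Qed.

Lemma pressure_ge0 A g : 0 < A -> measurable_fun setT g ->
  {ae mu, forall v, 0 <= g v} -> 0 <= pressure A g.
Proof.
move=> A0 mg g0; rewrite mulr_ge0 ?invr_ge0 ?mulr_ge0 ?exprn_ge0 ?(ltW A0)//.
apply: (moment_ge0 g (fun v => enorm v ^+ 2 / kin A v)) => //.
  apply: measurable_funM; first by apply: measurable_funX; exact: measurable_enorm.
  exact: measurable_kinV.
by move=> v; rewrite mulr_ge0 ?sqr_ge0// invr_ge0; exact/ltW/kin_gt0.
Qed.

(** Every particle carries at least its rest energy: [kin A v] >= A. *)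
Lemma energy_density_ge A g : 0 < A -> in_L 1 g ->
  {ae mu, forall v, 0 <= g v} -> num_particles g / A ^+ 3 <= energy_density A g.
Proof.
move=> A0 Lg g0.
have -> : num_particles g / A ^+ 3 = (A ^+ 4)^-1 * (A * num_particles g).
  by field; rewrite gt_eqF.
rewrite ler_pM2l ?invr_gt0 ?exprn_gt0// num_particlesE.
rewrite -(momentZ _ _ 1)//; last exact: le1_growth.
apply: (le_moment _ _ _ (A + 1)) => //.
- exact: measurable_kin.
- move=> v; rewrite mulr1 gtr0_norm//; have := enorm_ge0 v; nra.
- by move=> v; exact: kin_growth.
- by move=> v; rewrite mulr1; exact/le_kin/ltW.
Qed.

End Matter.

Section Lifespan.
Context {R : realType}.
Variables (sigma : R) (k : int) (F0 : R * R * R -> R) (a0 H0 phi0 : R).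
Hypothesis sigma_gt0 : 0 < sigma.
Hypothesis data : initial_data k F0 a0 H0 phi0.
Let N := num_particles F0.

Lemma num_particles_data_ge0 : 0 <= N.
Proof. by apply: Rintegral_ge0 => v _; exact: data_ge0 data v. Qed.

Section Solution.
Variables (T : \bar R) (F : R -> R * R * R -> R) (a H phi : R -> R).
Hypothesis sol : regular_solution sigma k F0 a0 H0 phi0 T F a H phi.
Let I := time_interval T.
Let rho t := energy_density (a t) (F t).
Let P t := pressure (a t) (F t).

Let C1_is_derive (f : R -> R) : C1_on I f ->
  forall t, I t -> is_derive t 1 f (f^`()%classic t).
Proof. by move=> f1 t It; rewrite derive1E; apply/derivableP; case: (f1 t It). Qed.

Lemma particles_conserved t : I t -> num_particles (F t) = N.
Proof.
have aC t' : I t' -> {for t', continuous a}.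
  move=> It'; apply/differentiable_continuous/derivable1_diffP.
  by case: (sol_a_C1 sol It').
apply: (particles_initial sigma T F a sigma_gt0 (sol_F_cont sol) (sol_F_ge0 sol)
  (sol_a_gt0 sol) aC (sol_fokker_planck sol)); first exact: (data_X data).1.
exact: sol_F_init sol.
Qed.

Lemma solution_matter t : I t ->
  [/\ 0 < a t, 0 <= P t, 0 <= rho t & N / a t ^+ 3 <= rho t].
Proof.
move=> It; have a_gt0 := sol_a_gt0 sol It.
have LF := ((sol_F_cont sol).1 t It).1; have [mF _ _] := in_L1E _ LF.
have F_ge0 := sol_F_ge0 sol It.
split => //; first exact: pressure_ge0.
  exact: energy_density_ge0.
by rewrite -(particles_conserved t It); exact: energy_density_ge.
Qed.

(** The bound [c] on H' is required for arbitrary values of scale factor, density and pressure, so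
    that [c], and with it the bound on [T], is the same for every solution. *)
Lemma solution_lifespan (J : R -> R) (c t1 : R) :
  (forall A rh p : R, 0 < A -> 0 <= rh -> 0 <= p -> N / A ^+ 3 <= rh ->
    - ((rh + p) / 2) + k%:~R / A ^+ 2 <= c) ->
  (forall t : R, is_derive t 1 J (expR (- (3 * H0 * t + 3 / 2 * c * t ^+ 2)))) ->
  J 0 = 0 -> 0 < t1 ->
  phi0 < 3 * sigma * N / a0 ^+ 3 * J t1 ->
  (T <= (t1 + pi / Num.min 1 ((3 * sigma * N / a0 ^+ 3 * J t1 - phi0) / 3))%:E)%E.
Proof.
move=> hc dJ J0 t10 hphi.
apply: (@cosmological_lifespan R T a H phi (H^`()%classic) J a0 H0 phi0
  (3 * sigma * N) c t1) => //.
- exact: data_a data.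
- by rewrite !mulr_ge0 ?num_particles_data_ge0 ?ltW.
- exact: sol_a_gt0 sol.
- by move=> t It; rewrite -(sol_a_ode sol It); apply: C1_is_derive It; exact: sol_a_C1 sol.
- by move=> t It; apply: C1_is_derive It; exact: sol_H_C1 sol.
- move=> t It; have := C1_is_derive phi (sol_phi_C1 sol) t It.
  by rewrite (sol_phi_ode sol It) particles_conserved.
- move=> t It; rewrite (sol_H_ode sol It); have [? ? ? ?] := solution_matter t It.
  exact: hc.
- move=> t It; rewrite (sol_H_ode sol It).
  have [_ P0 rho0 _] := solution_matter t It.
  have := sol_constraint sol It; rewrite /friedmann -/(rho t) -/(P t).
  move: (k%:~R / a t ^+ 2) => K; lra.
- exact: sol_a_init sol.
- exact: sol_H_init sol.
- exact: sol_phi_init sol.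
Qed.

End Solution.

Lemma blowup_criterion (J : R -> R) (c t1 : R) :
  (forall A rh p : R, 0 < A -> 0 <= rh -> 0 <= p -> N / A ^+ 3 <= rh ->
    - ((rh + p) / 2) + k%:~R / A ^+ 2 <= c) ->
  (forall t : R, is_derive t 1 J (expR (- (3 * H0 * t + 3 / 2 * c * t ^+ 2)))) ->
  J 0 = 0 -> 0 < t1 ->
  phi0 < 3 * sigma * N / a0 ^+ 3 * J t1 ->
  blows_up_in_finite_time sigma k F0 a0 H0 phi0.
Proof.
move=> hc dJ J0 t10 hphi; rewrite /blows_up_in_finite_time.
apply: le_lt_trans (ltry (t1 + pi / Num.min 1 ((3 * sigma * N / a0 ^+ 3 * J t1 - phi0) / 3))).
apply: ge_ereal_sup => T [F [a [H [phi sol]]]].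
exact: (solution_lifespan T F a H phi sol).
Qed.

End Lifespan.

Theorem theorem3p6 (R : realType) (sigma : R) (hsigma : 0 < sigma)
    (k : int) (hk : [\/ k = -1, k = 0 | k = 1])
    (F0 : R * R * R -> R) (a0 H0 phi0 : R)
    (hdata : initial_data k F0 a0 H0 phi0) :
  let N := num_particles F0 in
  let x := 9 * H0 * N / (4 * Num.sqrt 2) in
  ((k = 0 \/ k = -1) ->
     phi0 < sigma * N / (H0 * a0 ^+ 3) ->
     blows_up_in_finite_time sigma k F0 a0 H0 phi0) /\
  (k = 1 ->
     phi0 < 9 * sigma * N ^+ 2 / (4 * a0 ^+ 3) * Num.sqrt (pi / 2)
            * Erfc x * expR (x ^+ 2) ->
     blows_up_in_finite_time sigma k F0 a0 H0 phi0).
Proof.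
move=> N x.
have a00 : 0 < a0 := data_a hdata.
have H00 : 0 < H0 := data_H hdata.
have phi00 : 0 < phi0 := data_phi hdata.
have N0 : 0 <= N := num_particles_data_ge0 k F0 a0 H0 phi0 hdata.
have a3 : a0 != 0 by rewrite gt_eqF.
have H3 : H0 != 0 by rewrite gt_eqF.
split => [hk0 hphi|hk1 hphi].
(* Y is the limit of 3 sigma N / a0^3 times [J t] as t -> oo; z is the relative gap left by the
   hypothesis. *)
- pose Y := sigma * N / (H0 * a0 ^+ 3).
  have Y0 : 0 < Y by exact: lt_trans hphi.
  pose z := (Y - phi0) / Y.
  have z0 : 0 < z by rewrite divr_gt0// subr_gt0.
  have z1 : z < 1 by rewrite ltr_pdivrMr// mul1r gtrBl.
  (* Chosen so that exp(- 3 H0 t1) = z / 2: the accumulated decrease of phi is then Y (1 - z / 2),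
     the midpoint of phi0 and Y. *)
  pose t1 := - ln (z / 2) / (3 * H0).
  have z2 : 0 < z / 2 by rewrite divr_gt0.
  pose J (t : R) := (3 * H0)^-1 * (1 - expR (- (3 * H0) * t)).
  apply: (blowup_criterion sigma k F0 a0 H0 phi0 hsigma hdata J 0 t1).
  + move=> A rh p A0 rh0 p0 _.
    have kA : k%:~R / A ^+ 2 <= 0 :> R.
      rewrite pmulr_lle0 ?invr_gt0 ?exprn_gt0//.
      by case: hk0 => ->; rewrite ?mulrN1z ?lerN10.
    lra.
  + move=> t.
    have h := is_derive1_comp (is_derive_expR (- (3 * H0) * t)) (is_derive_mulr (- (3 * H0)) t).
    have := is_deriveZ (3 * H0)^-1 (is_deriveB (is_derive_cst (1 : R) t 1) h).
    move=> {}h; apply: (is_derive_eq h).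
    rewrite /GRing.scale/= !mulr0 !mul0r addr0 mulNr.
    by field.
  + by rewrite /J mulr0 expR0 subrr mulr0.
  + rewrite divr_gt0// ?mulr_gt0// oppr_gt0 ln_lt0// z2/=.
    by rewrite ltr_pdivrMr// mul1r (lt_trans z1)// ltr1n.
  + have -> : J t1 = (3 * H0)^-1 * (1 - z / 2).
      rewrite /J; congr (_ * (1 - _)).
      have -> : - (3 * H0) * t1 = ln (z / 2) by rewrite /t1; field.
      by rewrite lnK.
    have -> : 3 * sigma * N / a0 ^+ 3 * ((3 * H0)^-1 * (1 - z / 2)) = Y * (1 - z / 2).
      by rewrite /Y; field; rewrite a3.
    have -> : Y * (1 - z / 2) = (Y + phi0) / 2.
      by rewrite /z; field; rewrite gt_eqF.
    by move: hphi; rewrite -/Y; lra.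
(* N > 0 is read off the hypothesis: at N = 0 its right-hand side is 0, whereas phi0 > 0. *)
- have Nn0 : N != 0.
    apply/eqP => N0'; move: hphi; rewrite N0' expr0n/= mulr0 !mul0r.
    by rewrite ltNge (ltW phi00).
  have Ngt0 : 0 < N by rewrite lt_neqAle eq_sym Nn0.
  pose s2 : R := Num.sqrt 2.
  have s20 : 0 < s2 by rewrite sqrtr_gt0.
  have s2n : s2 != 0 by rewrite gt_eqF.
  have s22 : s2 ^+ 2 = 2 by rewrite sqr_sqrtr.
  (* With b^2 = 3 c / 2 and 2 x b = 3 H0 the square is completed: 3 H0 t + 3 c t^2 / 2 = (x + b t)^2
     - x^2. The second relation is what determines x in the statement. *)
  pose b := 2 * s2 / (3 * N).
  have b0 : 0 < b by rewrite divr_gt0// mulr_gt0.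
  pose c := 16 / (27 * N ^+ 2).
  pose K := expR (x ^+ 2) / b.
  pose J (t : R) := K * (gauss_cdf (x + b * t) - gauss_cdf x).
  pose Q := 3 * sigma * N / a0 ^+ 3 * K.
  have Q0 : 0 < Q.
    by rewrite mulr_gt0 ?divr_gt0 ?mulr_gt0 ?expR_gt0// exprn_gt0.
  pose G : R := \int[lebesgue_measure]_(s in `[x, +oo[) gauss_fun s.
  (* Q G is the right-hand side of the hypothesis, since Erfc x = 2 G / sqrt(pi). *)
  have tail : phi0 / Q < G.
    rewrite ltr_pdivrMr//; apply: (lt_le_trans hphi).
    rewrite le_eqVlt; apply/orP; left; apply/eqP.
    have -> : Erfc x = 2 / Num.sqrt pi * G by [].
    rewrite sqrtrM ?pi_ge0// sqrtrV// -/s2 /Q /K /b.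
    have sp : Num.sqrt pi != 0 :> R by rewrite gt_eqF// sqrtr_gt0 pi_gt0.
    set X := expR _.
    have -> : 3 * sigma * N / a0 ^+ 3 * (X / (2 * s2 / (3 * N))) =
      9 * sigma * N ^+ 2 / (4 * a0 ^+ 3) * X * (s2 ^+ 2) / s2.
      by rewrite s22; field; rewrite a3 s2n Nn0.
    by rewrite s22; field; rewrite a3 s2n sp.
  have [y xy hy] := gauss_tail_exceeds _ _ tail.
  pose t1 := (y - x) / b.
  apply: (blowup_criterion sigma k F0 a0 H0 phi0 hsigma hdata J c t1).
  + move=> A rh p A0 rh0 p0 hrh; rewrite hk1 mulr1z div1r.
    have An : A != 0 by rewrite gt_eqF.
    apply: (@le_trans _ _ (- (N / A ^+ 3 / 2) + A ^- 2)).
      by rewrite lerD2r lerN2; move: hrh; move: (N / A ^+ 3) => M; lra.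
    (* As a cubic in u = 1/A, the difference c - u^2 + N u^3 / 2 has a double root at the maximiser
       u = 4 / (3 N) and its remaining root is negative, hence the factorisation. *)
    rewrite -subr_ge0.
    have -> : c - (- (N / A ^+ 3 / 2) + A ^- 2) =
      N / 2 * (A^-1 - 4 / (3 * N)) ^+ 2 * (A^-1 + 2 / (3 * N)).
      by rewrite /c; field; rewrite An Nn0.
    apply: mulr_ge0; first by rewrite mulr_ge0 ?sqr_ge0// divr_ge0.
    by rewrite addr_ge0 ?invr_ge0 ?divr_ge0 ?mulr_ge0// ltW.
  + move=> t.
    have h1 : is_derive t 1 (fun t => x + b * t) b.
      have := is_deriveD (is_derive_cst x t 1) (is_derive_mulr b t).
      by rewrite add0r.
    have h2 := is_derive1_comp (g := fun t => x + b * t) (is_derive_gauss_cdf (x + b * t)) h1.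
    have h3 := is_deriveZ K (is_deriveB h2 (is_derive_cst (gauss_cdf x) t 1)).
    apply: (is_derive_eq h3).
    rewrite subr0 /GRing.scale/= /gauss_fun /K.
    have -> : expR (x ^+ 2) / b * (expR (- (x + b * t) ^+ 2) * b) =
        expR (x ^+ 2) * expR (- (x + b * t) ^+ 2).
      by field; rewrite gt_eqF.
    rewrite -expRD; congr expR.
    have xb : 2 * x * b = 3 * H0.
      by rewrite /x /b -/s2; field; rewrite s2n Nn0.
    have bb : b ^+ 2 = 3 / 2 * c.
      have -> : b ^+ 2 = 4 * s2 ^+ 2 / (9 * N ^+ 2) by rewrite /b; field.
      by rewrite s22 /c; field.
    by rewrite -xb -bb; ring.
  + by rewrite /J mulr0 addr0 subrr mulr0.
  + by rewrite divr_gt0// subr_gt0.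
  + have -> : J t1 = K * (gauss_cdf y - gauss_cdf x).
      rewrite /J /t1; congr (_ * (gauss_cdf _ - _)).
      by rewrite mulrCA divff ?gt_eqF// mulr1 addrC subrK.
    by rewrite mulrA -/Q mulrC -ltr_pdivrMr.
Qed.
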